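(* Let $X_1,\dots,X_n$ be i.i.d. with law $P$ on a measurable space $(\mathcal X,\mathcal A)$, and let $\mathcal F$ be a $P$-measurable class of measurable functions $f:\mathcal X\to\mathbb R$ with a measurable envelope function $F$ such that $PF^{(4p-2)/(p-1)}<\infty$ for some $p>1$, and such that the classes $\mathcal F^2=\{f^2:f\in\mathcal F\}$ and $\mathcal F^4=\{f^4:f\in\mathcal F\}$ are $P$-measurable. Suppose that $Pf^2<\delta^2PF^2$ for every $f\in\mathcal F$, for some $\delta\in(0,1)$. Then $$\mathrm E_P^*\|\mathbb G_n\|_{\mathcal F}\le C\,J(\delta,\mathcal F,L_2)\Bigl(1+\frac{J(\delta^{1/p},\mathcal F,L_2)}{\delta^2\sqrt n}\,\frac{\|F\|_{P,(4p-2)/(p-1)}^{2-1/p}}{\|F\|_{P,2}^{2-1/p}}\Bigr)^{p/(2p-1)}\|F\|_{P,2},$$ where $C$ is a constant depending only on $p$.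
   Context: The empirical process is $\mathbb G_nf=n^{-1/2}\sum_{i=1}^n (f(X_i)-Pf)$ and $\|\mathbb G_n\|_{\mathcal F}=\sup_{f\in\mathcal F}|\mathbb G_nf|$. $\mathrm E_P^*$ denotes outer expectation. An envelope function of $\mathcal F$ is a measurable $F$ with $|f|\le F$ for all $f\in\mathcal F$. $\|f\|_{Q,r}=(Q|f|^r)^{1/r}$. A class $\mathcal G$ is $P$-measurable if for every $n$ and every $(e_1,\dots,e_n)\in\{-1,1\}^n$ the map $(X_1,\dots,X_n)\mapsto\sup_{g\in\mathcal G}|\sum_{i=1}^n e_ig(X_i)|$ is measurable on the completion of $(\mathcal X^n,\mathcal A^n,P^n)$. The uniform entropy integral (relative to the envelope $F$) is $$J(\delta,\mathcal F,L_2)=\sup_Q\int_0^\delta\sqrt{1+\log N\bigl(\varepsilon\|F\|_{Q,2},\mathcal F,L_2(Q)\bigr)}\,d\varepsilon,$$ the supremum over all finitely discrete probability measures $Q$ on $(\mathcal X,\mathcal A)$, with $N(\varepsilon,\mathcal F,L_2(Q))$ the minimal number of $L_2(Q)$-balls of radius $\varepsilon$ needed to cover $\mathcal F$. *)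

(* Defs.v *)
From HB Require Import structures.
From mathcomp Require Import all_boot all_order all_algebra.
From mathcomp Require Import all_classical all_reals all_analysis.
From mathcomp Require Import measurable_realfun.
Set Implicit Arguments. Unset Strict Implicit. Unset Printing Implicit Defensive.
Import Order.TTheory GRing.Theory Num.Theory.
Import numFieldNormedType.Exports.
Local Open Scope classical_set_scope.
Local Open Scope ring_scope.

Definition is_product_measure {d} {T : measurableType d} {R : realType}
  (n : nat) (P : {measure set T -> \bar R})
  (mu : {measure set (n.-tuple T) -> \bar R}) : Prop :=
  forall B : 'I_n -> set T, (forall i, measurable (B i)) ->
    mu [set x | forall i, B i (tnth x i)] = (\prod_(i < n) P (B i))%E.

Definition completion_measurable {d} {Om : measurableType d} {R : realType}
  (mu : {measure set Om -> \bar R}) (h : Om -> \bar R) : Prop :=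
  forall B : set (\bar R), measurable B ->
    exists A N : set Om, [/\ measurable A, measurable N, mu N = 0%E &
      ((h @^-1` B) `\` A) `|` (A `\` (h @^-1` B)) `<=` N].

Definition P_measurable {d} {T : measurableType d} {R : realType}
  (P : {measure set T -> \bar R}) (G : set (T -> R)) : Prop :=
  forall (m : nat) (e : 'I_m -> bool) (mu : {measure set (m.-tuple T) -> \bar R}),
    is_product_measure P mu ->
    completion_measurable mu (fun x => ereal_sup
      [set (`| \sum_(i < m) (-1) ^+ e i * g (tnth x i) |)%:E | g in G]).

Definition outer_expect {d} {Om : measurableType d} {R : realType}
  (mu : {measure set Om -> \bar R}) (h : Om -> \bar R) : \bar R :=
  ereal_inf [set (\int[mu]_x U x)%E | U in
    [set U : Om -> \bar R | [/\ measurable_fun setT U, (forall x, (h x <= U x)%E) &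
       ((\int[mu]_x (U^\+ x) < +oo)%E \/ (\int[mu]_x (U^\- x) < +oo)%E)]]].

(* finitely discrete probability Q = sum_j w j * dirac (xs j) ; L2(Q) norm *)
Definition fd_prob {T} {R : realType} (k : nat) (xs : 'I_k -> T) (w : 'I_k -> R) :=
  (forall j, 0 < w j) /\ \sum_(j < k) w j = 1.

Definition L2fd {T} {R : realType} (k : nat) (xs : 'I_k -> T) (w : 'I_k -> R)
  (g : T -> R) : R := Num.sqrt (\sum_(j < k) w j * (g (xs j)) ^+ 2).

Definition covering_number {d} {T : measurableType d} {R : realType}
  (k : nat) (xs : 'I_k -> T) (w : 'I_k -> R) (eps : R) (G : set (T -> R)) : \bar R :=
  ereal_inf [set (m%:R)%:E | m in [set m : nat | exists c : 'I_m -> T -> R,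
     (forall j, measurable_fun setT (c j)) /\
     forall f, G f -> exists j, L2fd xs w (f \- c j) < eps]].

Definition entropy_integrand (R : realType) (N : \bar R) : \bar R :=
  match N with
  | r%:E => (Num.sqrt (1 + ln r))%:E
  | _ => +oo%E
  end.

Definition entropy_int {d} {T : measurableType d} {R : realType}
  (k : nat) (xs : 'I_k -> T) (w : 'I_k -> R)
  (delta : R) (G : set (T -> R)) (F : T -> R) : \bar R :=
  (\int[lebesgue_measure]_(e in `]0%R, delta[%classic)
       entropy_integrand (covering_number xs w (e * L2fd xs w F) G))%E.

Definition unif_entropy {d} {T : measurableType d} {R : realType}
  (delta : R) (G : set (T -> R)) (F : T -> R) : \bar R :=
  ereal_sup [set v | exists (k : nat) (xs : 'I_k -> T) (w : 'I_k -> R),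
    [/\ fd_prob xs w, 0 < L2fd xs w F & v = entropy_int xs w delta G F]].

(* Main.v *)
Require Import Defs.
From HB Require Import structures.
From mathcomp Require Import all_boot all_order all_algebra.
From mathcomp Require Import all_classical all_reals all_analysis.
From mathcomp Require Import measurable_realfun.
From mathcomp Require Import ring lra.
Import Order.TTheory GRing.Theory Num.Theory.
Import numFieldNormedType.Exports.
Local Open Scope classical_set_scope.
Local Open Scope ring_scope.

(** Symmetrization.  For a fixed sign vector [e], freezing the coordinates with
    a given sign and averaging out the others bounds the centered sum by twice
    the (outer) expectation of [sup_f |sum_i e_i f(X_i)|], up to
    [|sum_i e_i| sup_f |Pf|].  Averaging over [e] is legitimate because the
    suprema are measurable in the completion, and the extra term is harmless
    since [|Pf| <= delta ||F||] and [J(delta) >= delta / 4].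

    Chaining.  Conditionally on the sample, dyadic chaining along the covers at
    scales [2^-j delta], with radii inflated so as to start from a given bound
    [sigma] on the norms, yields [C J(delta) (||F||_n + sigma_n / delta)].
    This is linear in the random norms, so no concavity of [J] is needed.

    Self-bounding.  Let [z^2] be the outer expectation of [sup_f P_n f^2]
    divided by [P F^2].  The same two steps for the class of squares, whose
    entropy for the empirical measure is controlled by that of the class for
    the empirical measure reweighted by [F^2], combined with the interpolation
    [f^4 <= |f|^(2/p) F^(4-2/p)], give
    [z^2 <= C (delta^2 + n^(-1/2) J(delta^(1/p)) (1 + (z/delta)^(1/p)) r)]
    with [r = (||F||_q / ||F||_2)^(2-1/p)].  Solving for [z / delta] and
    inserting the result in the bound for the class itself gives the theorem. *)

(** * Rademacher averages *)

Section rademacher.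
Context {R : realType}.

(** The constant 2 is not sharp, but it allows an elementary proof. For small [x], the bounds exp(x)
    <= 1/(1-x) and exp(-x) <= 1/(1+x) average to 1/(1-x^2) <= 1+2x^2. For large [x], already |x| <=
    2x^2. *)
Lemma cosh_le_expR_sqr (x : R) : (expR x + expR (- x)) / 2 <= expR (2 * x ^+ 2).
Proof.
have [x2|x2] := leP (x ^+ 2) (1 / 2).
- have xlt1 : `|x| < 1.
    rewrite -(ltr_pXn2r (_ : (0 < 2)%N)) ?nnegrE// real_normK ?num_real// expr1n.
    lra.
  have /andP[x1 x1'] : -1 < x < 1 by rewrite -ltr_norml.
  have e1 : expR x <= (1 - x)^-1.
    rewrite -[X in X <= _]invrK -expRN lef_pV2 ?posrE ?expR_gt0//; last lra.
    exact: expR_ge1Dx.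
  have e2 : expR (- x) <= (1 + x)^-1.
    by rewrite expRN lef_pV2 ?posrE ?expR_gt0 ?expR_ge1Dx//; lra.
  apply: (@le_trans _ _ (1 + 2 * x ^+ 2)); last exact: expR_ge1Dx.
  apply: (@le_trans _ _ ((1 - x)^-1 / 2 + (1 + x)^-1 / 2)); first lra.
  have -> : (1 - x)^-1 / 2 + (1 + x)^-1 / 2 = (1 - x ^+ 2)^-1.
    by field; rewrite !gt_eqF//; nra.
  rewrite -div1r ler_pdivrMr; last lra.
  have := sqr_ge0 x; nra.
- have x0 : 1 / 2 <= `|x|.
    rewrite -(ler_pXn2r (_ : (0 < 2)%N)) ?nnegrE// real_normK ?num_real//.
    lra.
  have x2' : `|x| <= 2 * x ^+ 2.
    by rewrite -[x ^+ 2]real_normK ?num_real//; nra.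
  have h1 : expR x <= expR (2 * x ^+ 2).
    by rewrite ler_expR (le_trans _ x2')// ler_norm.
  have h2 : expR (- x) <= expR (2 * x ^+ 2).
    by rewrite ler_expR (le_trans _ x2')// -normrN ler_norm.
  lra.
Qed.

Definition signs n : finType := {ffun 'I_n -> bool}.

Definition rsum n (e : 'I_n -> bool) (a : 'I_n -> R) : R :=
  \sum_(i < n) (-1) ^+ e i * a i.

Definition rmean n (X : signs n -> R) : R := (2 ^+ n)^-1 * \sum_(e : signs n) X e.

Lemma rsumB n (e : 'I_n -> bool) a b :
  rsum n e (fun i => a i - b i) = rsum n e a - rsum n e b.
Proof. by rewrite /rsum -sumrB; apply: eq_bigr => i _; rewrite mulrBr. Qed.

Lemma rsumZ n (e : 'I_n -> bool) c a :
  rsum n e (fun i => c * a i) = c * rsum n e a.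
Proof. by rewrite /rsum mulr_sumr; apply: eq_bigr => i _; rewrite mulrCA. Qed.

Lemma rmean_le n X Y : (forall e, X e <= Y e) -> rmean n X <= rmean n Y.
Proof.
by move=> XY; rewrite /rmean ler_wpM2l ?invr_ge0 ?exprn_ge0//; exact: ler_sum.
Qed.

Lemma rmeanD n X Y : rmean n (fun e => X e + Y e) = rmean n X + rmean n Y.
Proof. by rewrite /rmean big_split/= mulrDr. Qed.

Lemma rmeanZ n c X : rmean n (fun e => c * X e) = c * rmean n X.
Proof. by rewrite /rmean -mulr_sumr mulrCA. Qed.

Lemma rmean_cst n c : rmean n (fun=> c) = c.
Proof.
rewrite /rmean sumr_const card_ffun card_bool card_ord -[c *+ _]mulr_natr natrX.
by rewrite mulrC mulfK// expf_neq0// pnatr_eq0.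
Qed.

Lemma rmean_sum n (I : finType) (X : I -> signs n -> R) :
  rmean n (fun e => \sum_i X i e) = \sum_i rmean n (X i).
Proof. by rewrite /rmean exchange_big mulr_sumr. Qed.

(** Independence of the signs appears here as distributivity: the sum over all sign vectors of a
    product is the product over coordinates of two-term sums. *)
Lemma rmean_expR_rsum n (a : 'I_n -> R) :
  rmean n (fun e => expR (rsum n e a)) <= expR (2 * \sum_(i < n) a i ^+ 2).
Proof.
have -> : rmean n (fun e => expR (rsum n e a)) =
    \prod_(i < n) ((expR (a i) + expR (- a i)) / 2).
  rewrite /rmean.
  under eq_bigr do rewrite /rsum expR_sum.
  rewrite -(bigA_distr_bigA (fun i (b : bool) => expR ((-1) ^+ b * a i))).
  under [in LHS]eq_bigr do rewrite big_bool/= expr1 expr0 mulN1r mul1r addrC.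
  by rewrite big_split/= prodr_const card_ord mulrC -exprVn.
rewrite mulr_sumr expR_sum; apply: ler_prod => i _.
by rewrite cosh_le_expR_sqr andbT divr_ge0.
Qed.

(* Instead of Jensen's inequality: [lam * y <= L - 1 + expR (lam * y - L)]. *)
Lemma rademacher_maximal n (K : finType) (a : K -> 'I_n -> R) (s : R)
    (k : signs n -> K) :
  (0 < s) -> (forall j, \sum_(i < n) a j i ^+ 2 <= s ^+ 2) ->
  rmean n (fun e => `|rsum n e (a (k e))|) <=
    3 * s * Num.sqrt (ln (2 * #|K|%:R)).
Proof.
move=> s0 as2.
have K0 : (0 < #|K|)%N by apply/card_gt0P; exists (k [ffun=> true]).
have K1 : 2 <= 2 * #|K|%:R :> R by rewrite ler_peMr// ler1n.
set l := ln _.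
have l0 : 0 < l by rewrite ln_gt0//; lra.
set q := Num.sqrt l.
have q0 : 0 < q by rewrite sqrtr_gt0.
have q2 : q ^+ 2 = l by rewrite sqr_sqrtr// ltW.
(* With this [lam] each scaled vector has squared norm at most [l], so each exponential moment is at
   most exp(2l). The choice [L = 3 * l] makes the [2 * #|K|] moments, multiplied by exp(-L), add up
   to at most 1, which cancels the -1 in [L - 1]. *)
pose lam := q / s.
have lam0 : 0 < lam by rewrite divr_gt0.
pose L := 3 * l.
suff H : rmean n (fun e => lam * `|rsum n e (a (k e))|) <= L.
  rewrite rmeanZ -ler_pdivlMl// in H.
  apply: le_trans H _.
  rewrite /L -q2 /lam invf_div le_eqVlt; apply/orP; left; apply/eqP.
  by field; rewrite gt_eqF.
(* The absolute value costs one exponential of each sign, and the selected index is dominated by the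
   sum over all of [K]; hence the factor [2 * #|K|]. *)
have step (e : signs n) : lam * `|rsum n e (a (k e))| <=
  (L - 1) + \sum_j (expR (- L) * (expR (rsum n e (fun i => lam * a j i)) +
    expR (rsum n e (fun i => (- lam) * a j i)))).
  set y := lam * _.
  have -> : y = L - 1 + (1 + (y - L)) by ring.
  rewrite lerD2l (le_trans (expR_ge1Dx _))//.
  rewrite expRD mulrC -mulr_sumr ler_wpM2l ?expR_ge0//.
  rewrite (bigD1 (k e))//= !rsumZ /y.
  apply: (@le_trans _ _ (expR (lam * rsum n e (a (k e))) +
                         expR (- lam * rsum n e (a (k e))))); last first.
    rewrite lerDl; apply: sumr_ge0 => j _.
    by rewrite addr_ge0// expR_ge0.
  case: (ger0P (rsum n e (a (k e)))) => _.
    by rewrite lerDl expR_ge0.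
  by rewrite mulrN mulNr lerDr expR_ge0.
apply: le_trans (rmean_le _ _ _ step) _.
rewrite rmeanD rmean_cst rmean_sum.
have mb c j : c ^+ 2 = lam ^+ 2 ->
    rmean n (fun e => expR (rsum n e (fun i => c * a j i))) <= expR (2 * l).
  move=> c2; apply: le_trans (rmean_expR_rsum _ _) _.
  rewrite ler_expR ler_pM2l//.
  under eq_bigr do rewrite exprMn.
  rewrite -mulr_sumr c2 -q2 /lam expr_div_n -mulrA ler_piMr ?sqr_ge0//.
  by rewrite mulrC ler_pdivrMr ?exprn_gt0// mul1r.
have : \sum_j rmean n (fun e => expR (- L) *
   (expR (rsum n e (fun i => lam * a j i)) +
    expR (rsum n e (fun i => - lam * a j i)))) <=
   \sum_(j : K) expR (- L) * (expR (2 * l) + expR (2 * l)).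
  apply: ler_sum => j _; rewrite rmeanZ rmeanD.
  by rewrite ler_wpM2l ?expR_ge0// lerD// mb// sqrrN.
move=> /(lerD (lexx (L - 1)))/le_trans; apply.
rewrite sumr_const -[X in _ + X <= _]mulr_natr.
have -> : expR (- L) * (expR (2 * l) + expR (2 * l)) * #|K|%:R =
   expR (- L) * expR (2 * l) * (2 * #|K|%:R) by ring.
rewrite -[X in _ * X]lnK ?posrE; last lra.
rewrite -/l -!expRD.
have -> : - L + 2 * l + l = 0 by rewrite /L; ring.
by rewrite expR0 subrK.
Qed.

End rademacher.

(** * Chaining *)

Section chaining.
Context {R : realType}.

(** Splits the cost of a pair of consecutive centers into two single-scale costs. The ones under the
    roots absorb ln 2 <= 1. *)
Lemma sqrtr_ln_mul_le (m k : nat) : (0 < m)%N -> (0 < k)%N ->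
  Num.sqrt (ln (2 * (m * k)%:R)) <=
    Num.sqrt (1 + ln m%:R) + Num.sqrt (1 + ln k%:R) :> R.
Proof.
move=> m0 k0.
have mR : 0 < m%:R :> R by rewrite ltr0n.
have kR : 0 < k%:R :> R by rewrite ltr0n.
have lm : 0 <= ln (m%:R : R) by rewrite ln_ge0// ler1n.
have lk : 0 <= ln (k%:R : R) by rewrite ln_ge0// ler1n.
set x := Num.sqrt (1 + ln m%:R); set y := Num.sqrt (1 + ln k%:R).
have x0 : 0 <= x by exact: sqrtr_ge0.
have y0 : 0 <= y by exact: sqrtr_ge0.
have x2 : x ^+ 2 = 1 + ln m%:R by rewrite sqr_sqrtr//; lra.
have y2 : y ^+ 2 = 1 + ln k%:R by rewrite sqr_sqrtr//; lra.
rewrite -[leRHS]ger0_norm ?addr_ge0// -sqrtr_sqr ler_sqrt ?sqr_ge0//.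
rewrite natrM !lnM ?posrE ?mulr_gt0//.
have l2 : ln (2 : R) <= 1.
  by have := @le_ln1Dx R 1; rewrite -[1 + 1]/(2 : R); apply; lra.
have := mulr_ge0 x0 y0; nra.
Qed.

Lemma sum_sqr_le_norm n (a : 'I_n -> R) (r : R) (i : 'I_n) : 0 <= r ->
  \sum_(j < n) a j ^+ 2 <= r ^+ 2 -> `|a i| <= r.
Proof.
move=> r0 ar; rewrite -(ler_pXn2r (_ : (0 < 2)%N)) ?nnegrE//.
rewrite real_normK ?num_real// (le_trans _ ar)// (bigD1 i)//= lerDl.
by apply: sumr_ge0 => j _; exact: sqr_ge0.
Qed.

Lemma sum_sqrB_le n (a b c : 'I_n -> R) (r s : R) :
  \sum_(i < n) (a i - b i) ^+ 2 <= r -> \sum_(i < n) (a i - c i) ^+ 2 <= s ->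
  \sum_(i < n) (b i - c i) ^+ 2 <= 2 * r + 2 * s.
Proof.
move=> ab ac.
apply: (@le_trans _ _ (2 * \sum_(i < n) (a i - b i) ^+ 2 +
                       2 * \sum_(i < n) (a i - c i) ^+ 2)); last lra.
rewrite !mulr_sumr -big_split/=; apply: ler_sum => i _.
have := sqr_ge0 ((a i - b i) + (a i - c i)); lra.
Qed.

Let L (m : nat) : R := Num.sqrt (1 + ln m%:R).

(** The supremum over [V] is represented by an arbitrary selector [v] of the signs. Each [v e] is
    joined to 0 through centers at radii r0/2^j. A link between consecutive levels has norm at most
    4 r0/2^(j+1) and is one of at most N(j+1) N(j) differences, so the maximal inequality applies;
    the remainder after [J] links is at most n r0/2^J. *)
Lemma rmean_chaining n (V : set ('I_n -> R)) (r0 A : R) (N : nat -> nat)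
    (c : nat -> nat -> 'I_n -> R) (v : signs n -> 'I_n -> R) :
  0 < r0 -> N 0%N = 1%N -> c 0%N 0%N = (fun=> 0) ->
  (forall j u, V u -> exists2 k, (k < N j)%N &
     \sum_(i < n) (u i - c j k i) ^+ 2 <= (r0 / 2 ^+ j) ^+ 2) ->
  (forall J, \sum_(0 <= j < J) r0 / 2 ^+ j.+1 * L (N j.+1) <= A) ->
  (forall e, V (v e)) ->
  rmean n (fun e => `|rsum n e (v e)|) <= 18 * A + 6 * r0.
Proof.
move=> r0_gt0 N0 c0 cov HA Vv.
have N_gt0 j : (0 < N j)%N.
  have [k kN _] := cov j _ (Vv [ffun=> true]).
  exact: leq_ltn_trans kN.
have /choice[kk kkP] : forall je : nat * signs n, exists k, (k < N je.1)%N /\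
    \sum_(i < n) (v je.2 i - c je.1 k i) ^+ 2 <= (r0 / 2 ^+ je.1) ^+ 2.
  by move=> [j e]; have [k kN H] := cov j _ (Vv e); exists k.
pose r j : R := r0 / 2 ^+ j.
have r_gt0 j : 0 < r j by rewrite divr_gt0// exprn_gt0.
have rS j : r j = 2 * r j.+1.
  by rewrite /r exprS invfM; field; rewrite expf_neq0.
have link J : rmean n (fun e => `|rsum n e (c J (kk (J, e)))|) <=
    \sum_(0 <= j < J) 12 * (r j.+1 * (L (N j.+1) + L (N j))).
  elim: J => [|J IH].
    rewrite big_geq// (_ : (fun e => _) = fun=> 0) ?rmean_cst//.
    apply/funext => e; have [/= + _] := kkP (0%N, e).
    rewrite N0; case: (kk _) => // _; rewrite c0 /rsum big1 ?normr0// => i _.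
    by rewrite mulr0.
  rewrite big_nat_recr//=.
  (* Pairs of centers that are too far apart are sent to the zero vector, so that the norm bound
     holds for every index. The selected pairs are always close: 2r^2 + 2(2r)^2 <= (4r)^2. *)
  pose a (kl : 'I_(N J.+1) * 'I_(N J)) : 'I_n -> R :=
    if \sum_(i < n) (c J.+1 kl.1 i - c J kl.2 i) ^+ 2 <= (4 * r J.+1) ^+ 2
    then fun i => c J.+1 kl.1 i - c J kl.2 i else fun=> 0.
  pose k (e : signs n) : 'I_(N J.+1) * 'I_(N J) :=
    (Ordinal (kkP (J.+1, e)).1, Ordinal (kkP (J, e)).1).
  have ak e : a (k e) = fun i => c J.+1 (kk (J.+1, e)) i - c J (kk (J, e)) i.
    rewrite /a ifT//=.
    have [_ h1] := kkP (J.+1, e); have [_ h2] := kkP (J, e).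
    apply: le_trans (sum_sqrB_le _ _ _ _ _ _ h1 h2) _; rewrite -!/(r _) /= (rS J).
    by have := sqr_ge0 (r J.+1); nra.
  have H : rmean n (fun e => `|rsum n e (a (k e))|) <=
      3 * (4 * r J.+1) * Num.sqrt (ln (2 * #|{: 'I_(N J.+1) * 'I_(N J)}|%:R)).
    apply: rademacher_maximal => [|kl]; first by rewrite mulr_gt0.
    rewrite /a; case: ifPn => // _.
    by rewrite big1 ?sqr_ge0// => i _; rewrite expr0n.
  apply: (@le_trans _ _ (rmean n (fun e => `|rsum n e (c J (kk (J, e)))| +
                                           `|rsum n e (a (k e))|))).
    apply: rmean_le => e; rewrite ak rsumB.
    by rewrite (le_trans _ (ler_normD _ _))// addrC subrK.
  rewrite rmeanD lerD// (le_trans H)// card_prod !card_ord.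
  have := sqrtr_ln_mul_le _ _ (N_gt0 J.+1) (N_gt0 J); rewrite -!/(L _) => h.
  have := r_gt0 J.+1; nra.
have main J : rmean n (fun e => `|rsum n e (v e)|) <=
    18 * A + 6 * r0 + n%:R * r0 / 2 ^+ J.
  apply: (@le_trans _ _ (rmean n (fun e => `|rsum n e (c J (kk (J, e)))| +
     n%:R * r J))).
    apply: rmean_le => e.
    have -> : rsum n e (v e) = rsum n e (c J (kk (J, e))) +
       rsum n e (fun i => v e i - c J (kk (J, e)) i) by rewrite rsumB addrC subrK.
    rewrite (le_trans (ler_normD _ _))// lerD2l.
    rewrite (le_trans (ler_norm_sum _ _ _))//.
    apply: (@le_trans _ _ (\sum_(i < n) r J)); last first.
      by rewrite sumr_const card_ord -[leLHS]mulr_natl.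
    apply: ler_sum => i _; rewrite normrM normrX normrN1 expr1n mul1r.
    apply: (sum_sqr_le_norm n (fun i => v e i - c J (kk (J, e)) i)).
      exact: ltW.
    exact: (kkP (J, e)).2.
  rewrite rmeanD rmean_cst mulrA lerD2r.
  rewrite (le_trans (link J))//.
  (* Since r(j) = 2 r(j+1), the two parts are at most 12A and 6(r0 + A); the extra r0 is the term j
     = 0, where the single center has cost 1. *)
  have -> : \sum_(0 <= j < J) 12 * (r j.+1 * (L (N j.+1) + L (N j))) =
     12 * \sum_(0 <= j < J) r j.+1 * L (N j.+1) +
     6 * \sum_(0 <= j < J) r j * L (N j).
    rewrite !mulr_sumr -big_split/=; apply: eq_bigr => j _.
    by rewrite (rS j); ring.
  have : \sum_(0 <= j < J) r j * L (N j) <= r0 + A.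
    case: J => [|J].
      by have := HA 0%N; rewrite !big_geq//; lra.
    rewrite big_nat_recl//= lerD//.
    by rewrite /r expr0 divr1 /L N0 ln1 addr0 sqrtr1 mulr1.
  have := HA J; rewrite -/(r _); lra.
apply/ler_addgt0Pr => eps eps0.
pose J := (Num.trunc (n%:R * r0 / eps)).+1.
apply: le_trans (main J) _; rewrite lerD2l ler_pdivrMr ?exprn_gt0//.
rewrite -ler_pdivrMl// mulrC.
have /ltW : n%:R * r0 / eps < J%:R by rewrite truncnS_gt.
move=> /le_trans; apply.
by rewrite -natrX ler_nat ltnW// ltn_expl.
Qed.

End chaining.

(** * Entropy integrals *)

Section dyadic_integral.
Context {R : realType}.
Local Open Scope ereal_scope.

(* No measurability is needed: the integral of a nonnegative function is the
   supremum over the simple functions below it. *)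
Lemma ge0_le_integral_sup d (T : measurableType d)
    (mu : {measure set T -> \bar R}) (D : set T) (f g : T -> \bar R) :
  (forall x, D x -> 0 <= f x) -> (forall x, D x -> f x <= g x) ->
  \int[mu]_(x in D) f x <= \int[mu]_(x in D) g x.
Proof.
move=> f0 fg; rewrite !ge0_integralE//; last first.
  by move=> x Dx; rewrite (le_trans (f0 _ Dx))// fg.
apply: le_ereal_sup => _ [h /= hf <-]; exists h => // x.
by rewrite (le_trans (hf x))//; exact: lee_restrict.
Qed.

(** On the interval from delta/2^(j+2) to delta/2^(j+1), whose length is the coefficient in the sum,
    the nonincreasing [g] is at least its value at the right end. The intervals are disjoint, so the
    resulting step function lies below [g]. *)
Lemma dyadic_sum_le_integral (g : R -> \bar R) (delta : R) (J : nat) :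
  (0 < delta)%R -> (forall x, 0 <= g x) ->
  (forall x y, (0 < x)%R -> (x <= y)%R -> g y <= g x) ->
  \sum_(0 <= j < J) (delta / 2 ^+ j.+2)%:E * g (delta / 2 ^+ j.+1)%R <=
  \int[lebesgue_measure]_(x in `]0%R, delta[%classic) g x.
Proof.
move=> d0 g0 gmono.
pose eps j : R := (delta / 2 ^+ j)%R.
have eps0 j : (0 < eps j)%R by rewrite divr_gt0// exprn_gt0.
have epsS j : (eps j = 2 * eps j.+1)%R.
  by rewrite /eps exprS invfM; field; rewrite expf_neq0.
pose I j : set R := `]eps j.+2, eps j.+1]%classic.
pose h J x := \sum_(0 <= j < J) ((cst (g (eps j.+1))) \_ (I j)) x.
have term0 j x : 0 <= ((cst (g (eps j.+1))) \_ (I j)) x.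
  by rewrite patchE; case: ifPn => _ /=.
(* The second clause strengthens the induction: the next interval lies where the previous step
   function still vanishes, so at most one term is active at [x]. *)
have hg K x : (0 < x)%R -> h K x <= g x /\ ((x <= eps K.+1)%R -> h K x = 0).
  move=> x0; elim: K => [|K [IH1 IH2]]; first by rewrite /h big_geq.
  rewrite /h big_nat_recr//= -/(h K x) patchE.
  case: ifPn => [/set_mem|_].
    rewrite /I /= in_itv/= => /andP[xl xu]; rewrite IH2// add0e; split; first exact: gmono.
    by rewrite leNgt xl.
  rewrite adde0; split => // xK; apply: IH2.
  by rewrite (le_trans xK)// [leRHS]epsS ler_peMl ?ler1n// ltW.
apply: le_trans (ge0_le_integral_sup _ _ lebesgue_measure _ (h J) g _ _);
  last 2 first.
- by move=> x _; apply: sume_ge0 => j _; exact: term0.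
- by move=> x /=; rewrite in_itv/= => /andP[x0 _]; exact: (hg J x x0).1.
rewrite /h ge0_integral_sum//; last first.
  by move=> j; apply/measurable_restrict;
    [exact: measurable_itv|exact: measurable_itv|exact: measurable_cst].
apply: lee_sum => j _.
rewrite -integral_mkcondr integral_cst//; last first.
  by apply: measurableI; exact: measurable_itv.
have -> : (`]0%R, delta[%classic `&` I j)%classic = I j.
  apply/setIidr => x; rewrite /I /= !in_itv/= => /andP[xl xu].
  rewrite (lt_trans _ xl)//= (le_lt_trans xu)//.
  by rewrite /eps ltr_pdivrMr ?exprn_gt0// ltr_pMr// exprn_egt1// ltr1n.
have mI : lebesgue_measure (I j) = (eps j.+1 - eps j.+2)%:E.
  rewrite /I lebesgue_measure_itv/= lte_fin.
  by rewrite ifT// [ltRHS]epsS ltr_pMl// ltr1n.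
rewrite [leLHS]muleC [X in _ <= _ * X](_ : _ = (eps j.+1 - eps j.+2)%:E)//.
have -> // : (delta / 2 ^+ j.+2 = eps j.+1 - eps j.+2)%R.
by rewrite (epsS j.+1) -/(eps j.+2); ring.
Qed.

End dyadic_integral.

Section entropy.
Context {R : realType} d (T : measurableType d).
Variables (k : nat) (xs : 'I_k -> T) (w : 'I_k -> R).
Implicit Types (G : set (T -> R)) (F : T -> R).

Definition covers m (eps : R) G := exists c : 'I_m -> T -> R,
  (forall j, measurable_fun setT (c j)) /\
  forall f, G f -> exists j, L2fd xs w (f \- c j) < eps.

Lemma covers_monotone m eps eps' G : eps <= eps' -> covers m eps G ->
  covers m eps' G.
Proof.
move=> ee [c [mc cG]]; exists c; split=> // f /cG[j fj].
by exists j; exact: lt_le_trans ee.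
Qed.

(** An infimum over natural numbers is attained unless no finite cover exists, so a finite covering
    number comes with an actual cover of that size. *)
Lemma covering_numberP eps G :
  covering_number xs w eps G = +oo%E \/
  exists2 m : nat, covering_number xs w eps G = m%:R%:E & covers m eps G.
Proof.
have [H|H] := pselect (exists m, covers m eps G); last first.
  left; apply/eqP; rewrite eq_le leey/=; apply: le_ereal_inf_tmp => _ [m/= cm <-].
  by exfalso; apply: H; exists m.
right.
have [m cm mmin] : exists2 m, covers m eps G & forall m', covers m' eps G -> (m <= m')%N.
  have H' : exists m, `[< covers m eps G >] by case: H => m cm; exists m; exact/asboolP.
  case: (ex_minnP H') => m /asboolP cm mmin; exists m => // m' cm'.
  by apply: mmin; exact/asboolP.
exists m => //; apply/eqP; rewrite eq_le; apply/andP; split.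
  by apply: ereal_inf_lbound; exists m.
by apply: le_ereal_inf_tmp => _ [m'/= cm' <-]; rewrite lee_fin ler_nat mmin.
Qed.

(** The value [m = 0] is the covering number of an empty class; it relies on the convention ln 0 =
    0. *)
Lemma ln_nat_ge0 (m : nat) : 0 <= ln (m%:R : R).
Proof. by case: m => [|m]; [rewrite ln0|rewrite ln_ge0// ler1n]. Qed.

Lemma ln_nat_le (m m' : nat) : (m <= m')%N -> ln (m%:R : R) <= ln (m'%:R : R).
Proof.
case: m => [_|m mm']; first by rewrite ln0// ln_nat_ge0.
by rewrite ler_ln ?posrE ?ltr0n ?ler_nat// (leq_trans _ mm').
Qed.

Lemma covering_number_le m eps G : covers m eps G ->
  (covering_number xs w eps G <= m%:R%:E)%E.
Proof. by move=> cm; apply: ereal_inf_lbound; exists m. Qed.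

Lemma entropy_integrand_ge1 eps G :
  (1 <= entropy_integrand (covering_number xs w eps G))%E.
Proof.
have [->|[m -> _]] := covering_numberP eps G; first exact: leey.
by rewrite /= lee_fin -[X in X <= _]sqrtr1 ler_sqrt ?ler_wpDr ?addr_ge0 ?ln_nat_ge0.
Qed.

Lemma entropy_integrand_nonincreasing eps eps' G : eps <= eps' ->
  (entropy_integrand (covering_number xs w eps' G) <=
   entropy_integrand (covering_number xs w eps G))%E.
Proof.
move=> ee; have [->|[m -> cm]] := covering_numberP eps G; first exact: leey.
have {cm} := covering_number_le _ _ _ (covers_monotone _ _ _ _ ee cm).
have [->|[m' -> _]] := covering_numberP eps' G; first by rewrite leye_eq.
rewrite lee_fin ler_nat => mm'.
by rewrite lee_fin ler_sqrt ?lerD2l ?ln_nat_le// addr_ge0// ln_nat_ge0.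
Qed.

Lemma dyadic_sum_le_entropy_int (delta : R) G F (J : nat) : 0 < delta ->
  (\sum_(0 <= j < J) (delta / 2 ^+ j.+2)%:E * entropy_integrand
     (covering_number xs w (delta / 2 ^+ j.+1 * L2fd xs w F) G) <=
   entropy_int xs w delta G F)%E.
Proof.
move=> d0; apply: (dyadic_sum_le_integral (fun e => entropy_integrand
     (covering_number xs w (e * L2fd xs w F) G))) => // [x|x y x0 xy].
  by rewrite (le_trans _ (entropy_integrand_ge1 _ _)).
by apply: entropy_integrand_nonincreasing; rewrite ler_wpM2r// sqrtr_ge0.
Qed.

Lemma entropy_int_ge (delta : R) G F : 0 < delta ->
  ((delta / 4)%:E <= entropy_int xs w delta G F)%E.
Proof.
move=> d0; apply: le_trans (dyadic_sum_le_entropy_int delta G F 1 d0).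
rewrite big_nat1.
have -> : delta / 4 = delta / 2 ^+ 2 by congr (_ / _); ring.
rewrite -[leLHS]mule1 lee_wpmul2l ?entropy_integrand_ge1//.
by rewrite lee_fin divr_ge0// ltW.
Qed.

(** The radii are inflated from [rho] to [rho' = rho + sigma / delta]. The initial radius
    [rho' * delta] is then at least [sigma], so the zero vector alone covers [V] at level 0, while
    covers of radius [eps * rho] still serve at the larger radius. The hypothesis introduced as
    [transfer] turns covers of [G] into covers of [V]. *)
Lemma rmean_le_entropy_int n (V : set ('I_n -> R)) G F
    (rho sigma delta Jv : R) (v : signs n -> 'I_n -> R) :
  0 < rho -> 0 <= sigma -> 0 < delta ->
  (forall eps m, 0 < eps -> covers m (eps * L2fd xs w F) G ->
    exists b : nat -> 'I_n -> R, forall u, V u -> exists2 l, (l < m)%N &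
      \sum_(i < n) (u i - b l i) ^+ 2 <= (eps * rho) ^+ 2) ->
  (forall u, V u -> \sum_(i < n) u i ^+ 2 <= sigma ^+ 2) ->
  (entropy_int xs w delta G F <= Jv%:E)%E ->
  (forall e, V (v e)) ->
  rmean n (fun e => `|rsum n e (v e)|) <= 60 * Jv * (rho + sigma / delta).
Proof.
move=> rho0 sigma0 d0 transfer Vsigma HJ Vv.
pose rho' := rho + sigma / delta.
have sd0 : 0 <= sigma / delta by rewrite divr_ge0// ltW.
have rho'0 : 0 < rho' by rewrite /rho' ltr_wpDr.
pose eps j : R := delta / 2 ^+ j.
have eps0 j : 0 < eps j by rewrite divr_gt0// exprn_gt0.
pose g j := entropy_integrand (covering_number xs w (eps j * L2fd xs w F) G).
have g0 j : (0 <= g j)%E by rewrite (le_trans _ (entropy_integrand_ge1 _ _)).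
have sumg J : (\sum_(0 <= j < J) (eps j.+2)%:E * g j.+1 <= Jv%:E)%E.
  exact: le_trans (dyadic_sum_le_entropy_int _ _ _ _ d0) HJ.
have covj j : exists Nb : nat * (nat -> 'I_n -> R),
    g j.+1 = (Num.sqrt (1 + ln Nb.1%:R))%:E /\
    forall u, V u -> exists2 l, (l < Nb.1)%N &
      \sum_(i < n) (u i - Nb.2 l i) ^+ 2 <= (eps j.+1 * rho) ^+ 2.
  rewrite /g; have [Noo|[m Nm cm]] := covering_numberP (eps j.+1 * L2fd xs w F) G.
    (* One infinite covering number would make the dyadic sum infinite, against the real bound
       [Jv]. *)
    exfalso; have := sumg j.+1.
    rewrite big_nat_recr//= /g Noo/= mulry gtr0_sg// mul1e addey// ?leye_eq//.
    rewrite gt_eqF// (lt_le_trans (ltNyr 0%R))//.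
    by apply: sume_ge0 => i _; apply: mule_ge0; [rewrite lee_fin ltW|exact: g0].
  have [b Hb] := transfer _ _ (eps0 _) cm.
  by exists (m, b); rewrite Nm.
have [Nb NbP] := choice covj.
pose N j := if j is j'.+1 then (Nb j').1 else 1%N.
pose c j := if j is j'.+1 then (Nb j').2 else fun _ _ => 0.
(* This absorbs the starting radius: 18 (2 rho' Jv) + 6 rho' delta <= (36 + 24) rho' Jv. *)
have dJ : delta <= 4 * Jv.
  have := le_trans (entropy_int_ge delta G F d0) HJ; rewrite lee_fin; lra.
apply: le_trans
  (rmean_chaining n V (rho' * delta) (2 * rho' * Jv) N c v _ _ _ _ _ Vv) _ => //.
- by rewrite mulr_gt0.
- move=> [|j] u Vu /=.
    exists 0%N => //; under eq_bigr do rewrite subr0.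
    rewrite (le_trans (Vsigma _ Vu))// expr0 divr1 ler_pXn2r ?nnegrE//.
      by rewrite /rho' mulrDl divfK ?gt_eqF// lerDr mulr_ge0// ltW.
    by rewrite mulr_ge0// ltW.
  have [_ /(_ u Vu)[l lN H]] := NbP j; exists l => //.
  apply: le_trans H _.
  rewrite -mulrA -/(eps _) [rho' * _]mulrC.
  have e1 := eps0 j.+1; have rr : rho <= rho' by rewrite lerDl.
  by apply: lerXn2r; rewrite ?nnegrE; nra.
- move=> J.
  have := sumg J.
  have -> : (\sum_(0 <= j < J) (eps j.+2)%:E * g j.+1 =
      (\sum_(0 <= j < J) eps j.+2 * Num.sqrt (1 + ln (N j.+1)%:R))%:E)%E.
    by rewrite -sumEFin; apply: eq_bigr => j _; rewrite (NbP j).1.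
  rewrite lee_fin => H.
  have -> : \sum_(0 <= j < J) rho' * delta / 2 ^+ j.+1 *
      Num.sqrt (1 + ln (N j.+1)%:R) =
    2 * rho' * \sum_(0 <= j < J) eps j.+2 * Num.sqrt (1 + ln (N j.+1)%:R).
    rewrite mulr_sumr; apply: eq_bigr => j _.
    by rewrite /eps [in RHS]exprS invfM; field; rewrite expf_neq0.
  by rewrite ler_pM2l// mulr_gt0.
- rewrite -/rho'; nra.
Qed.

End entropy.

(** * Conditional Rademacher bounds from entropy of weighted empirical measures *)

Section empirical_entropy.
Context {R : realType} d (T : measurableType d).

(** Since [fd_prob] asks for strictly positive weights, the measure is indexed by the support [A] of
    [om]. Repeated sample points are harmless, as the atoms [xs] need not be distinct. *)
Lemma weighted_empirical_fd_prob n (x : n.-tuple T) (om : 'I_n -> R) :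
  (forall i, 0 <= om i) -> 0 < \sum_(i < n) om i ->
  exists (k : nat) (xs : 'I_k -> T) (w : 'I_k -> R), fd_prob xs w /\
    forall g : T -> R, L2fd xs w g ^+ 2 =
      (\sum_(i < n) om i * g (tnth x i) ^+ 2) / \sum_(i < n) om i.
Proof.
move=> om0 S0; set S := \sum_(i < n) om i in S0 *.
pose A := [pred i : 'I_n | om i != 0].
have restr (h : 'I_n -> R) :
    \sum_(j < #|A|) om (enum_val j) * h (enum_val j) = \sum_(i < n) om i * h i.
  rewrite -(big_enum_val (fun i => om i * h i)).
  rewrite [RHS](bigID A)/= [X in _ = _ + X]big1 ?addr0// => i.
  by rewrite negbK => /eqP ->; rewrite mul0r.
exists #|A|, (fun j => tnth x (enum_val j)), (fun j => om (enum_val j) / S).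
split.
  split=> [j|]; last first.
    rewrite -mulr_suml; under eq_bigr do rewrite -[om _]mulr1.
    rewrite (restr (fun=> 1)); under eq_bigr do rewrite mulr1.
    by rewrite divff// gt_eqF.
  by rewrite divr_gt0// lt_neqAle om0 andbT eq_sym; exact: (enum_valP j).
move=> g; rewrite sqr_sqrtr; last first.
  by apply: sumr_ge0 => j _; rewrite mulr_ge0 ?sqr_ge0// divr_ge0// ltW.
under eq_bigr do rewrite mulrAC.
by rewrite -mulr_suml (restr (fun i => g (tnth x i) ^+ 2)).
Qed.

(** The weights [om] choose the discrete measure, [phi] the vector attached to a function, and [K]
    compares distances between vectors with the weighted distance between functions. The class
    itself uses unit weights; the class of squares uses the weights F^2. *)
Lemma rmean_le_unif_entropy n (x : n.-tuple T) (om : 'I_n -> R)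
    (phi : (T -> R) -> 'I_n -> R) (Fc : set (T -> R)) (F : T -> R)
    (K rho sigma delta Jv : R) (f : signs n -> T -> R) :
  (forall i, 0 <= om i) -> 0 <= K -> 0 < rho -> 0 <= sigma -> 0 < delta ->
  rho ^+ 2 = K * \sum_(i < n) om i * F (tnth x i) ^+ 2 ->
  (forall c : T -> R, exists b : 'I_n -> R, forall g, Fc g ->
    \sum_(i < n) (phi g i - b i) ^+ 2 <=
    K * \sum_(i < n) om i * (g (tnth x i) - c (tnth x i)) ^+ 2) ->
  (forall g, Fc g -> \sum_(i < n) phi g i ^+ 2 <= sigma ^+ 2) ->
  (unif_entropy delta Fc F <= Jv%:E)%E ->
  (forall e, Fc (f e)) ->
  rmean n (fun e => `|rsum n e (phi (f e))|) <= 60 * Jv * (rho + sigma / delta).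
Proof.
move=> om0 K0 rho0 sigma0 d0 rhoE transfer Hs HJ Ff.
have P0 : 0 < K * \sum_(i < n) om i * F (tnth x i) ^+ 2.
  by rewrite -rhoE exprn_gt0.
have F0 : 0 < \sum_(i < n) om i * F (tnth x i) ^+ 2.
  rewrite lt_neqAle sumr_ge0 ?andbT => [|i _]; last by rewrite mulr_ge0 ?sqr_ge0.
  by apply: contraTneq P0 => <-; rewrite mulr0 ltxx.
have S0 : 0 < \sum_(i < n) om i.
  rewrite lt_neqAle sumr_ge0// andbT eq_sym; apply/negP => /eqP om_eq0.
  move: F0; rewrite big1 ?ltxx// => i _.
  have /psumr_eq0P/(_ i isT) -> := om_eq0; first by rewrite mul0r.
  by move=> j _; exact: om0.
have [k [xs [w [fdw L2E]]]] := weighted_empirical_fd_prob n x om om0 S0.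
set S := \sum_(i < n) om i in S0 L2E.
have L2F : 0 < L2fd xs w F.
  rewrite lt_neqAle sqrtr_ge0 andbT eq_sym; apply/negP => /eqP L0.
  by have := L2E F; rewrite L0 expr0n/= => /eqP; rewrite lt_eqF// divr_gt0.
apply: (rmean_le_entropy_int _ _ k xs w n [set phi g | g in Fc] Fc F _ _ _ _
  (fun e => phi (f e)) rho0 sigma0 d0).
- move=> eps m eps0 [c [_ cov]].
  have [b Hb] := choice transfer.
  (* Centers are indexed by all naturals, with the zero vector as default beyond the [m] actual
     ones. *)
  exists (fun l i => if insub l is Some j then b (c j) i else 0).
  move=> _ [g Fg <-]; have [j gj] := cov _ Fg; exists j => //; rewrite valK.
  apply: le_trans (Hb (c j) g Fg) _.
  rewrite exprMn rhoE mulrCA ler_wpM2l//.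
  have : L2fd xs w (g \- c j) ^+ 2 <= (eps * L2fd xs w F) ^+ 2.
    by rewrite lerXn2r ?nnegrE ?sqrtr_ge0 ?mulr_ge0 ?sqrtr_ge0 ?ltW.
  rewrite exprMn !L2E mulrA ler_pM2r// invr_gt0//.
- by move=> _ [g Fg <-]; exact: Hs.
- by apply: le_trans HJ; apply: ereal_sup_ubound; exists k, xs, w.
- by move=> e; exists (f e).
Qed.

(** For each of the finitely many sign vectors a function within [eta] of the supremum is chosen;
    these choices form a selector, and [eta] is arbitrary. The bound [M] keeps the suprema
    finite. *)
Lemma rmean_sup_le n (I : Type) (G : set I) (h : signs n -> I -> R) (M B : R) :
  G !=set0 -> (forall e f, G f -> h e f <= M) ->
  (forall f : signs n -> I, (forall e, G (f e)) ->
    rmean n (fun e => h e (f e)) <= B) ->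
  (\sum_(e : signs n) ((2 ^+ n)^-1)%:E * ereal_sup [set (h e f)%:E | f in G] <=
   B%:E)%E.
Proof.
move=> [f0 Gf0] hM hB.
pose s e := ereal_sup [set (h e f)%:E | f in G].
have sfin e : s e \is a fin_num.
  rewrite fin_real//; apply/andP; split.
    by apply: (lt_le_trans (ltNyr (h e f0))); apply: ereal_sup_ubound; exists f0.
  apply: (@le_lt_trans _ _ M%:E); last exact: ltry.
  by apply: ge_ereal_sup => _ [f Gf <-]; rewrite lee_fin hM.
have -> : (\sum_(e : signs n) ((2 ^+ n)^-1)%:E * s e =
    (rmean n (fun e => fine (s e)))%:E)%E.
  rewrite /rmean mulr_sumr -sumEFin; apply: eq_bigr => e _.
  by rewrite EFinM fineK.
rewrite lee_fin; apply/ler_addgt0Pr => eta eta0.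
have /choice[f fP] : forall e, exists f, G f /\ fine (s e) <= h e f + eta.
  move=> e; have : ((fine (s e) - eta)%:E < s e)%E.
    by rewrite -[X in (_ < X)%E](fineK (sfin e)) lte_fin ltrBlDr ltrDl.
  move=> /ereal_sup_gt[_ [f Gf <-]]; rewrite lte_fin => /ltW.
  by rewrite lerBlDr => H; exists f.
apply: (@le_trans _ _ (rmean n (fun e => h e (f e) + eta))).
  by apply: rmean_le => e; exact: (fP e).2.
by rewrite rmeanD rmean_cst lerD2r hB// => e; exact: (fP e).1.
Qed.

Lemma rsum_norm_le n (e : 'I_n -> bool) (a b : 'I_n -> R) :
  (forall i, `|a i| <= b i) -> `|rsum n e a| <= \sum_(i < n) b i.
Proof.
move=> ab; apply: le_trans (ler_norm_sum _ _ _) _; apply: ler_sum => i _.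
by rewrite normrM normrX normrN1 expr1n mul1r.
Qed.

(** Clipping a center to [-F, F] does not move it away from [a], and then a^2 - t^2 = (a+t)(a-t)
    with |a+t| <= 2F. The factor F^2 is what the reweighting of the empirical measure absorbs. *)
Lemma truncation_sqrB (a c F : R) : `|a| <= F ->
  (a ^+ 2 - Num.max (- F) (Num.min F c) ^+ 2) ^+ 2 <=
  4 * (F ^+ 2 * (a - c) ^+ 2).
Proof.
move=> aF; have /andP[aF1 aF2] : - F <= a <= F by rewrite -ler_norml.
set t := Num.max _ _.
have [tl th] : - F <= t /\ t <= F.
  split; rewrite /t; first by rewrite le_max lexx.
  by rewrite ge_max ge_min lexx andbT; lra.
have tc : (a - t) ^+ 2 <= (a - c) ^+ 2.
  rewrite /t; have [cF|cF] := leP F c.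
    by rewrite max_r; [nra|lra].
  by have [cF'|cF'] := leP (- F) c; nra.
have s2 : (a + t) ^+ 2 <= 4 * F ^+ 2 by nra.
have -> : (a ^+ 2 - t ^+ 2) ^+ 2 = (a + t) ^+ 2 * (a - t) ^+ 2 by ring.
rewrite mulrA; apply: ler_pM => //; exact: sqr_ge0.
Qed.

Definition rademacher_sup n (G : set (T -> R)) (x : n.-tuple T) : \bar R :=
  (\sum_(e : signs n) ((2 ^+ n)^-1)%:E *
    ereal_sup [set `|rsum n e (fun i => g (tnth x i))|%:E | g in G])%E.

Section classes.
Variables (Fc : set (T -> R)) (F : T -> R) (delta Jv : R).
Hypotheses (Fc0 : Fc !=set0) (FcF : forall f, Fc f -> forall x, `|f x| <= F x).
Hypotheses (d0 : 0 < delta) (HJ : (unif_entropy delta Fc F <= Jv%:E)%E).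
Hypothesis Jv0 : 0 <= Jv.

Lemma rademacher_class n (x : n.-tuple T) (sigma : R) : 0 <= sigma ->
  (forall f, Fc f -> \sum_(i < n) f (tnth x i) ^+ 2 <= sigma ^+ 2) ->
  (rademacher_sup n Fc x <=
   (60 * Jv * (Num.sqrt (\sum_(i < n) F (tnth x i) ^+ 2) + sigma / delta))%:E)%E.
Proof.
move=> s0 Hs.
apply: (rmean_sup_le n _ Fc (fun e f => `|rsum n e (fun i => f (tnth x i))|)
  (\sum_(i < n) F (tnth x i))) => //.
  by move=> e f Ff; apply: rsum_norm_le => i; exact: FcF.
move=> f Ff.
have S0 : 0 <= \sum_(i < n) F (tnth x i) ^+ 2.
  by apply: sumr_ge0 => i _; exact: sqr_ge0.
(* If the envelope vanishes on the sample, no measure with positive envelope norm is available, but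
   then all the signed sums are zero. *)
have [Fx0|Fx0] := eqVneq (\sum_(i < n) F (tnth x i) ^+ 2) 0.
  rewrite (_ : (fun e => _) = fun=> 0) ?rmean_cst ?mulr_ge0//.
    by rewrite Fx0 sqrtr0 add0r divr_ge0// ltW.
  apply/funext => e; rewrite /rsum big1 ?normr0// => i _.
  have /psumr_eq0P/(_ i isT) : \sum_(i < n) F (tnth x i) ^+ 2 = 0 by [].
  move=> /(_ (fun j _ => sqr_ge0 _))/eqP; rewrite sqrf_eq0 => /eqP F0.
  by have := FcF _ (Ff e) (tnth x i); rewrite F0 normr_le0 => /eqP ->; rewrite mulr0.
apply: (rmean_le_unif_entropy n x (fun=> 1) (fun f i => f (tnth x i)) Fc F 1) => //.
- by rewrite sqrtr_gt0 lt_neqAle S0 andbT eq_sym.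
- by rewrite sqr_sqrtr// mul1r; under [RHS]eq_bigr do rewrite mul1r.
- move=> c; exists (fun i => c (tnth x i)) => g Fg.
  by rewrite mul1r; under [leRHS]eq_bigr do rewrite mul1r.
Qed.

(** Weights F^2 and [K = 4] match the Lipschitz bound for clipped squares; the envelope then has
    squared weighted size 4 times the sum of F^4, which explains the factor 2 before the root. *)
Lemma rademacher_class_sqr n (x : n.-tuple T) (sigma : R) : 0 <= sigma ->
  (forall f, Fc f -> \sum_(i < n) f (tnth x i) ^+ 4 <= sigma ^+ 2) ->
  (rademacher_sup n [set (fun x => f x ^+ 2)%R | f in Fc] x <=
   (60 * Jv * (2 * Num.sqrt (\sum_(i < n) F (tnth x i) ^+ 4) + sigma / delta))%:E)%E.
Proof.
move=> s0 Hs.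
have F0 t : 0 <= F t by have [f /FcF/(_ t)] := Fc0; apply: le_trans.
have -> : rademacher_sup n [set (fun x => f x ^+ 2) | f in Fc] x =
    (\sum_(e : signs n) ((2 ^+ n)^-1)%:E *
      ereal_sup [set `|rsum n e (fun i => f (tnth x i) ^+ 2)|%:E | f in Fc])%E.
  apply: eq_bigr => e _; congr (_ * ereal_sup _)%E; apply/seteqP; split.
    by move=> _ [_ [f Ff <-] <-]; exists f.
  by move=> _ [f Ff <-]; exists (fun x => f x ^+ 2) => //; exists f.
apply: (rmean_sup_le n _ Fc (fun e f => `|rsum n e (fun i => f (tnth x i) ^+ 2)|)
  (\sum_(i < n) F (tnth x i) ^+ 2)) => //.
  move=> e f Ff; apply: rsum_norm_le => i.
  by rewrite normrX lerXn2r ?nnegrE ?FcF.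
move=> f Ff.
have S0 : 0 <= \sum_(i < n) F (tnth x i) ^+ 4.
  by apply: sumr_ge0 => i _; exact: exprn_ge0.
have [Fx0|Fx0] := eqVneq (\sum_(i < n) F (tnth x i) ^+ 4) 0.
  rewrite (_ : (fun e => _) = fun=> 0) ?rmean_cst ?mulr_ge0//.
    by rewrite Fx0 sqrtr0 mulr0 add0r divr_ge0// ltW.
  apply/funext => e; rewrite /rsum big1 ?normr0// => i _.
  have /psumr_eq0P/(_ i isT) : \sum_(i < n) F (tnth x i) ^+ 4 = 0 by [].
  move=> /(_ (fun j _ => exprn_ge0 _ (F0 _)))/eqP; rewrite expf_eq0/= => /eqP F0'.
  have := FcF _ (Ff e) (tnth x i); rewrite F0' normr_le0 => /eqP ->.
  by rewrite expr0n mulr0.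
apply: (rmean_le_unif_entropy n x (fun i => F (tnth x i) ^+ 2)
  (fun f i => f (tnth x i) ^+ 2) Fc F 4) => //.
- by move=> i; exact: sqr_ge0.
- by rewrite mulr_gt0// sqrtr_gt0 lt_neqAle S0 andbT eq_sym.
- rewrite exprMn sqr_sqrtr// [in RHS](eq_bigr (fun i => F (tnth x i) ^+ 4)); last first.
    by move=> i _; ring.
  by congr (_ * _); ring.
- move=> c; exists (fun i =>
    Num.max (- F (tnth x i)) (Num.min (F (tnth x i)) (c (tnth x i))) ^+ 2) => g Fg.
  rewrite mulr_sumr; apply: ler_sum => i _.
  exact/truncation_sqrB/FcF.
- move=> g Fg; rewrite (eq_bigr (fun i => g (tnth x i) ^+ 4)) ?Hs// => i _.
  by rewrite -exprM.
Qed.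

End classes.
End empirical_entropy.

(** * Product measures and completion *)

Section product_measure.
Context {R : realType}.

Lemma pushforward_measureP d1 d2 (X : measurableType d1) (Y : measurableType d2)
    (mu : {measure set X -> \bar R}) (phi : X -> Y) : measurable_fun setT phi ->
  exists m : {measure set Y -> \bar R}, m = pushforward mu phi :> (set Y -> \bar R).
Proof.
move=> mphi.
by exists (measure_function_pushforward__canonical__measure_function_Measure mu mphi).
Qed.

Context d (T : measurableType d) (n : nat).
Implicit Types B : 'I_n -> set T.

Definition box B : set (n.-tuple T) := [set x | forall i, B i (tnth x i)].

Lemma measurable_box B : (forall i, measurable (B i)) -> measurable (box B).
Proof.
move=> mB.
have -> : box B = \bigcap_(i in [set: 'I_n]) ((@tnth n T ^~ i) @^-1` B i).
  by apply/seteqP; split => x; [move=> xB i _; exact: xB|move=> xB i; exact: xB].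
apply: fin_bigcap_measurable => // i _.
by rewrite -[X in measurable X]setTI; apply: measurable_tnth.
Qed.

Definition boxes : set (set (n.-tuple T)) :=
  [set A | exists2 B, (forall i, measurable (B i)) & A = box B].

Lemma measurable_tupleE : @measurable _ (n.-tuple T) = <<s boxes >>.
Proof.
apply/seteqP; split; last first.
  apply: smallest_sub; first exact: sigma_algebra_measurable.
  by move=> _ [B mB ->]; exact: measurable_box.
apply: smallest_sub; first exact: smallest_sigma_algebra.
rewrite -bigcup_seq => A [i /= _ [C mC <-]].
apply: sub_sigma_algebra; exists (fun j => if j == i then C else setT).
  by move=> j; case: ifP.
apply/seteqP; split => x.
  by move=> [_ Cx] j; case: ifPn => // /eqP ->.
by move=> /(_ i); rewrite eqxx.
Qed.

Section measures.
Variables (P : probability T R).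

Lemma product_measure_setT (m : {measure set (n.-tuple T) -> \bar R}) :
  is_product_measure P m -> m setT = 1%E.
Proof.
move=> /(_ (fun=> setT) (fun=> measurableT)) H.
rewrite -[LHS](_ : m [set x : n.-tuple T | forall i, setT (tnth x i)] = _); last first.
  by congr (m _); apply/seteqP; split.
by rewrite H big1// => i _; exact: probability_setT.
Qed.

(** Boxes are stable under intersection and generate the sigma-algebra, so a measure is determined
    by its values on them. *)
Lemma product_measure_unique_tuple (m1 m2 : {measure set (n.-tuple T) -> \bar R}) :
  is_product_measure P m1 -> is_product_measure P m2 ->
  forall A, measurable A -> m1 A = m2 A.
Proof.
move=> h1 h2; apply: (measure_unique boxes (fun=> setT)).
- exact: measurable_tupleE.
- move=> _ _ [B mB ->] [C mC ->]; exists (fun i => B i `&` C i).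
    by move=> i; exact: measurableI.
  by apply/seteqP; split => [x [xB xC] i|x xBC]; [split|split=> i; case: (xBC i)].
- by move=> _; exists (fun=> setT) => //; apply/seteqP; split.
- by apply/seteqP; split => // x _; exists 0%N.
- by move=> _ [B mB ->]; rewrite [LHS]h1// [RHS]h2.
- by move=> _; rewrite product_measure_setT// ltry.
Qed.

Variable mu : probability (n.-tuple T) R.
Hypothesis Pmu : is_product_measure P mu.

Lemma pushforward_tnth (i : 'I_n) (A : set T) : measurable A ->
  pushforward mu (@tnth n T ^~ i) A = P A.
Proof.
move=> mA; rewrite /pushforward.
have := Pmu (fun j => if j == i then A else setT); rewrite (bigD1 i)//= eqxx.
rewrite big1 ?mule1 => [<-|j /negbTE ->]; last exact: probability_setT.
- congr (mu _); apply/seteqP; split => x /=; last by move=> /(_ i); rewrite eqxx.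
  by move=> Ax j; case: ifPn => // /eqP ->.
- by move=> j; case: ifP.
Qed.

Lemma ge0_integral_tnth (i : 'I_n) (f : T -> \bar R) : measurable_fun setT f ->
  (forall x, 0 <= f x)%E ->
  (\int[mu]_x f (tnth x i) = \int[P]_y f y)%E.
Proof.
move=> mf f0; have mi := @measurable_tnth _ T n i.
have [m mE] := pushforward_measureP _ _ _ _ mu _ mi.
have := ge0_integral_pushforward mi mu measurableT mf (fun y _ => f0 y).
rewrite preimage_setT -mE => <-; apply: eq_measure_integral => A mA _.
by rewrite mE pushforward_tnth.
Qed.

Lemma integrable_tnth (i : 'I_n) (f : T -> \bar R) : P.-integrable setT f ->
  mu.-integrable setT (fun x => f (tnth x i)).
Proof.
move=> /integrableP[mf fi]; have mi := @measurable_tnth _ T n i.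
apply/integrableP; split; first exact: measurableT_comp.
by rewrite (ge0_integral_tnth i (fun x => `|f x|%E))//; exact: measurableT_comp.
Qed.

Lemma integral_tnth (i : 'I_n) (f : T -> \bar R) : P.-integrable setT f ->
  (\int[mu]_x f (tnth x i) = \int[P]_y f y)%E.
Proof.
move=> fi; have mi := @measurable_tnth _ T n i.
have [m mE] := pushforward_measureP _ _ _ _ mu _ mi.
have mf : measurable_fun setT f by case/integrableP : fi.
have := @integral_pushforward _ _ _ _ _ _ mi mu setT f mf (integrable_tnth i f fi) measurableT.
rewrite preimage_setT -mE => <-; apply: eq_measure_integral => A mA _.
by rewrite mE pushforward_tnth.
Qed.

Definition mix (b : 'I_n -> bool) (xy : n.-tuple T * n.-tuple T) : n.-tuple T :=
  [tuple if b i then tnth xy.1 i else tnth xy.2 i | i < n].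

Lemma measurable_mix b : measurable_fun setT (mix b).
Proof.
apply/measurable_fun_tnthP => i.
rewrite (_ : _ \o _ = if b i then (@tnth n T ^~ i) \o fst else (@tnth n T ^~ i) \o snd).
  by case: (b i); apply: measurableT_comp => //; exact: measurable_tnth.
by apply/funext => xy /=; rewrite tnth_mktuple; case: (b i).
Qed.

(** Combining two independent samples coordinatewise gives again a sample with law [mu]: the
    preimage of a box under [mix b] is a product of two boxes, and their measures multiply to that
    of the box. *)
Lemma ge0_integral_mix b (U : n.-tuple T -> \bar R) : measurable_fun setT U ->
  (forall x, 0 <= U x)%E ->
  (\int[mu]_x \int[mu]_y U (mix b (x, y)) = \int[mu]_x U x)%E.
Proof.
move=> mU U0; have mm := measurable_mix b.
have mUm : measurable_fun setT (U \o mix b) by exact: measurableT_comp.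
rewrite -[LHS](fubini_tonelli1 (m1 := mu) (m2 := mu) (U \o mix b))//; last first.
  by move=> xy; exact: U0.
have [m mE] := pushforward_measureP _ _ _ _ (mu \x mu)%E _ mm.
have := ge0_integral_pushforward mm (mu \x mu)%E measurableT mU (fun y _ => U0 y).
rewrite preimage_setT -mE => <-; apply: eq_measure_integral => A mA _.
apply: product_measure_unique_tuple => // B mB.
rewrite mE /pushforward.
have -> : mix b @^-1` [set x | forall i, B i (tnth x i)] =
    box (fun i => if b i then B i else setT) `*`
    box (fun i => if b i then setT else B i).
  apply/seteqP; split=> [[x y]/= H|[x y]/= [H1 H2] i].
    split=> i /=; have := H i; rewrite tnth_mktuple /=; by case: (b i).
  by rewrite tnth_mktuple /=; move: (H1 i) (H2 i) => /=; case: (b i).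
transitivity (mu (box (fun i => if b i then B i else setT)) *
              mu (box (fun i => if b i then setT else B i)))%E.
  by apply: product_measure1E; apply: measurable_box => i; case: (b i).
rewrite [X in (X * _)%E]Pmu; last by move=> i; case: (b i).
rewrite [X in (_ * X)%E]Pmu; last by move=> i; case: (b i).
rewrite -big_split/=; apply: eq_bigr => i _.
by case: (b i); rewrite probability_setT ?mule1 ?mul1e.
Qed.

End measures.
End product_measure.

(** Rays with rational endpoints determine [h], so countably many exceptional null sets suffice.
    Setting the majorant to +oo on their union keeps it above [h] everywhere, not only almost
    everywhere. *)
Lemma completion_measurable_majorant {R : realType} d (Om : measurableType d)
    (mu : {measure set Om -> \bar R}) (h : Om -> \bar R) :
  completion_measurable mu h ->
  exists (U : Om -> \bar R) (N : set Om), [/\ measurable_fun setT U,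
    measurable N, mu N = 0%E, forall x, (h x <= U x)%E &
    forall x, ~ N x -> U x = h x].
Proof.
move=> hm.
pose q k : R := ratr (odflt 0 (unpickle k)).
have dense (r : R) (z : \bar R) : (r%:E < z)%E -> exists2 k, r < q k & ((q k)%:E < z)%E.
  move=> rz; have [s rs sz] : exists2 s : R, r < s & (s%:E <= z)%E.
    case: z rz => [s|_|//]; first by rewrite lte_fin; exists s.
    by exists (r + 1); [rewrite ltrDl|exact: leey].
  have [t] := rat_in_itvoo rs; rewrite in_itv/= => /andP[rt ts].
  exists (pickle t); rewrite /q pickleK//=.
  by rewrite (lt_le_trans _ sz)// lte_fin.
pose ray k : set (\bar R) := `](q k)%:E, +oo[%classic.
have /choice[AN ANP] : forall k, exists AN : set Om * set Om,
    [/\ measurable AN.1, measurable AN.2, mu AN.2 = 0%E &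
    ((h @^-1` (ray k)) `\` AN.1) `|` (AN.1 `\` (h @^-1` (ray k))) `<=` AN.2].
  move=> k; have [A [N H]] := hm (ray k) (emeasurable_itv _).
  by exists (A, N).
pose N := \bigcup_k (AN k).2.
have mN : measurable N by apply: bigcupT_measurable => k; case: (ANP k).
have hA x k : ~ N x -> (AN k).1 x <-> ((q k)%:E < h x)%E.
  move=> xN; have [_ _ _ sub] := ANP k; split=> [Ax|hx].
    apply: contrapT => hx; apply: xN; exists k => //; apply: sub; right; split=> //.
    by rewrite /ray /= in_itv/= andbT.
  apply: contrapT => Ax; apply: xN; exists k => //; apply: sub; left; split=> //.
  by rewrite /ray /= in_itv/= andbT.
pose U x := if x \in N then +oo%E else h x.
have UN x : ~ N x -> U x = h x by move=> xN; rewrite /U memNset.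
exists U, N; split => //.
- apply: (measurability _ (ErealGenOInfty.measurableE R)) => _ [_ [r ->] <-].
  rewrite setTI.
  have -> : U @^-1` `]r%:E, +oo[ = N `|` \bigcup_(k in [set k | r < q k]) (AN k).1.
    apply/seteqP; split=> x /=; rewrite in_itv/= andbT => H.
      have [xN|xN] := pselect (N x); [by left|right].
      by move: H; rewrite UN// => /dense[k rk kh]; exists k => //; exact/hA.
    have [xN|xN] := pselect (N x); first by rewrite /U mem_set ?ltry.
    rewrite UN//; case: H => // -[k /= rk /(hA _ _ xN)]; apply: lt_trans.
    by rewrite lte_fin.
  apply: measurableU => //; apply: bigcup_measurable => k _.
  by case: (ANP k).
- apply/(measure0_null_setP _ mN)/negligible_null_set.
  apply: negligible_bigcup => k; have [_ mk k0 _] := ANP k.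
  by exists (AN k).2; split.
- move=> x; rewrite /U; case: ifPn => // _; exact: leey.
Qed.

(** * Symmetrization *)

Lemma integral_cst_probability {R : realType} d (T : measurableType d)
  (P : probability T R) (c : \bar R) : (\int[P]_x c = c)%E.
Proof.
rewrite -[RHS]mule1 -(probability_setT P); exact: integral_cst.
Qed.

Section symmetrization.
Context {R : realType} d (T : measurableType d) (n : nat).
Variables (P : probability T R) (mu : probability (n.-tuple T) R).
Hypothesis Pmu : is_product_measure P mu.

Let mean (g : T -> R) : R := fine (\int[P]_y (g y)%:E)%E.

Lemma outer_expect_le_integral (h U : n.-tuple T -> \bar R) :
  measurable_fun setT U -> (forall x, 0 <= U x)%E -> (forall x, h x <= U x)%E ->
  (outer_expect mu h <= \int[mu]_x U x)%E.
Proof.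
move=> mU U0 hU; apply: ereal_inf_lbound; exists U => //; split => //; right.
rewrite (eq_integral (cst 0%E)) ?integral0 ?ltry// => x _.
by rewrite funenegE max_r// leeNl oppe0.
Qed.

(* Freezing the coordinates in [b] and averaging out the others isolates
   the centered partial sum over [b], up to a multiple of the mean. *)
Lemma partial_rsum_le (e b : 'I_n -> bool) (g : T -> R) (S : R)
    (U : n.-tuple T -> \bar R) (x : n.-tuple T) :
  P.-integrable setT (EFin \o g) -> `|mean g| <= S ->
  measurable_fun setT U ->
  (forall y, (`|rsum n e (fun i => g (tnth y i))|%:E <= U y)%E) ->
  ((`|\sum_(i < n) (if b i then (-1) ^+ e i * (g (tnth x i) - mean g) else 0)|)%:E
    <= \int[mu]_y U (mix d T n b (x, y)) + (`|rsum n e (fun=> 1)| * S)%:E)%E.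
Proof.
move=> gi gS mU gU.
have mg : measurable_fun setT g.
  by have /integrableP[/measurable_EFinP] := gi.
pose term i (y : n.-tuple T) : \bar R :=
  (((-1) ^+ e i)%:E * (g (if b i then tnth x i else tnth y i))%:E)%E.
have mi i : mu.-integrable setT (fun y : n.-tuple T => (g (tnth y i))%:E).
  exact: (integrable_tnth _ _ _ P mu Pmu i (EFin \o g)).
have ti i : mu.-integrable setT
    (fun y => (g (if b i then tnth x i else tnth y i))%:E).
  case: (b i); last exact: mi.
  exact: (finite_measure_integrable_cst mu (g (tnth x i)) measurableT).
have termi i : mu.-integrable setT (term i) by exact: integrableZl.
have Eterm i : (\int[mu]_y term i y =
    ((-1) ^+ e i * (if b i then g (tnth x i) else mean g))%:E)%E.
  rewrite /term integralZl// EFinM; congr (_ * _)%E.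
  case: (b i).
    by rewrite integral_cst_probability.
  rewrite (integral_tnth _ _ _ P mu Pmu i (EFin \o g))// /mean fineK//.
  exact: integrable_fin_num.
have sumE : (\int[mu]_y (\sum_(i < n) term i y) =
    (\sum_(i < n) (-1) ^+ e i * (if b i then g (tnth x i) else mean g))%:E)%E.
  by rewrite integral_sum// -sumEFin; apply: eq_bigr => i _.
have mpair : measurable_fun setT (fun y : n.-tuple T => (x, y)).
  by apply: measurable_fun_pair; [exact: measurable_cst|exact: measurable_id].
have le1 : (`|\sum_(i < n) (-1) ^+ e i * (if b i then g (tnth x i) else mean g)|%:E
    <= \int[mu]_y U (mix d T n b (x, y)))%E.
  rewrite -abse_EFin -sumE.
  apply: le_trans (le_abse_integral _ _ _) _ => //.
    by apply: emeasurable_sum => i; case/integrableP : (termi i).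
  apply: ge0_le_integral => //.
  - apply: measurableT_comp => //.
    by apply: emeasurable_sum => i; case/integrableP : (termi i).
  - exact: (measurableT_comp mU (measurableT_comp (measurable_mix d T n b) mpair)).
  - move=> y _; apply: le_trans (gU (mix d T n b (x, y))).
    rewrite /term; under eq_bigr do rewrite -EFinM.
    rewrite sumEFin abse_EFin lee_fin le_eqVlt; apply/orP; left; apply/eqP.
    by congr (`| _ |); apply: eq_bigr => i _; rewrite tnth_mktuple.
(* Coordinates outside [b] have been averaged to the mean, so subtracting the mean times the sum of
   all signs cancels them and centers those in [b]. *)
have -> : \sum_(i < n) (if b i then (-1) ^+ e i * (g (tnth x i) - mean g) else 0) =
    \sum_(i < n) (-1) ^+ e i * (if b i then g (tnth x i) else mean g) -
    rsum n e (fun=> 1) * mean g.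
  rewrite /rsum mulr_suml -sumrB; apply: eq_bigr => i _.
  by case: (b i); ring.
apply: (@le_trans _ _ (`|\sum_(i < n) (-1) ^+ e i *
   (if b i then g (tnth x i) else mean g)| + `|rsum n e (fun=> 1)| * S)%:E).
  rewrite lee_fin (le_trans (ler_normB _ _))// lerD2l normrM.
  by rewrite ler_wpM2l.
by rewrite EFinD leeD2r.
Qed.

(** The maximal inequality for a single vector of ones, with ln 2 <= 1. *)
Lemma rmean_norm_rsum1_le : (0 < n)%N ->
  rmean n (fun e => `|rsum n e (fun=> 1)|) <= 3 * Num.sqrt n%:R :> R.
Proof.
move=> n0.
have sn : 0 < Num.sqrt n%:R :> R by rewrite sqrtr_gt0 ltr0n.
apply: le_trans (rademacher_maximal n unit (fun _ _ => 1) (Num.sqrt n%:R)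
  (fun=> tt) sn _) _.
  move=> _; under eq_bigr do rewrite expr1n.
  by rewrite sumr_const card_ord sqr_sqrtr.
rewrite card_unit mulr1 ler_piMr//.
rewrite -[leRHS]sqrtr1 ler_sqrt//.
by have := @le_ln1Dx R 1; rewrite -[1 + 1]/(2 : R); apply; lra.
Qed.

(** For fixed signs the coordinates split into those of sign -1 and those of sign +1, and each
    centered partial sum is bounded by freezing that half. This bounds the outer expectation for
    every sign vector; averaging the bounds then produces the Rademacher supremum. The function [h]
    enters only through an affine bound in the centered sums, which covers both the process and the
    sums of squares. *)
Lemma symmetrization (G : set (T -> R)) (S A c bB : R)
    (B h : n.-tuple T -> \bar R) :
  (0 < n)%N -> G !=set0 -> P_measurable P G ->
  (forall g, G g -> P.-integrable setT (EFin \o g)) ->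
  (forall g, G g -> `|mean g| <= S) -> 0 <= A -> 0 <= c ->
  measurable_fun setT B -> (forall x, rademacher_sup d T n G x <= B x)%E ->
  (\int[mu]_x B x <= bB%:E)%E ->
  (forall x u, (forall g, G g ->
       (`|\sum_(i < n) (g (tnth x i) - mean g)|%:E <= u)%E) ->
     (h x <= A%:E + c%:E * u)%E) ->
  (outer_expect mu h <= (A + c * (2 * bB + 6 * Num.sqrt n%:R * S))%:E)%E.
Proof.
move=> n0 [g0 Gg0] mG Gi GS A0 c0 mB supB iB hP.
have S0 : 0 <= S by rewrite (le_trans _ (GS _ Gg0)).
pose k (e : signs n) (x : n.-tuple T) := ereal_sup
  [set `|rsum n e (fun i => g (tnth x i))|%:E | g in G].
have k0 e x : (0 <= k e x)%E.
  apply: (@le_trans _ _ `|rsum n e (fun i => g0 (tnth x i))|%:E).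
    by rewrite lee_fin.
  by apply: ereal_sup_ubound; exists g0.
have /choice[UN UNP] : forall e : signs n,
    exists UN : (n.-tuple T -> \bar R) * set (n.-tuple T),
    [/\ measurable_fun setT UN.1, measurable UN.2, mu UN.2 = 0%E,
      forall x, (k e x <= UN.1 x)%E & forall x, ~ UN.2 x -> UN.1 x = k e x].
  move=> e; have := mG n e mu Pmu.
  by move=> /completion_measurable_majorant[U [N H]]; exists (U, N).
pose U e := (UN e).1.
have mU e : measurable_fun setT (U e) by case: (UNP e).
have kU e x : (k e x <= U e x)%E by case: (UNP e).
have U0 e x : (0 <= U e x)%E by exact: le_trans (kU e x).
(* Each [U e] equals the supremum only off a null set, so the comparison with [B] is almost
   everywhere, off a finite union of null sets. *)
have meanU : (\sum_(e : signs n) ((2 ^+ n)^-1)%:E * \int[mu]_x U e x <= bB%:E)%E.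
  have -> : (\sum_(e : signs n) ((2 ^+ n)^-1)%:E * \int[mu]_x U e x =
      \int[mu]_x \sum_(e : signs n) ((2 ^+ n)^-1)%:E * U e x)%E.
    rewrite ge0_integral_sum//; last 2 first.
    - by move=> e; exact: measurable_funeM.
    - by move=> e x _; rewrite mule_ge0// lee_fin invr_ge0 exprn_ge0.
    by apply: eq_bigr => e _; rewrite ge0_integralZl_EFin// => x _; exact: U0.
  apply: le_trans iB; apply: ae_ge0_le_integral => //.
  - by move=> x _; apply: sume_ge0 => e _; rewrite mule_ge0// lee_fin invr_ge0 exprn_ge0.
  - by apply: emeasurable_sum => e; exact: measurable_funeM.
  - move=> x _; apply: le_trans (supB x); apply: sume_ge0 => e _.
    by rewrite mule_ge0// ?k0// lee_fin invr_ge0 exprn_ge0.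
  pose N := \big[setU/set0]_(e : signs n) (UN e).2.
  have : mu.-negligible N.
    apply: (big_ind (fun A => mu.-negligible A)).
    - exact: negligible_set0.
    - exact: negligibleU.
    - by move=> e _; have [_ mN N0 _ _] := UNP e; exists (UN e).2; split.
  apply: negligibleS => x /= H; apply: contrapT => xN; apply: H => _.
  apply: le_trans (supB x); apply: lee_sum => e _.
  have [_ _ _ _ Uk] := UNP e; rewrite /U Uk//.
  by move=> Nx; apply: xN; rewrite /N -bigcup_seq; exists e => //=; rewrite mem_index_enum.
have Ufin e : (\int[mu]_x U e x)%E \is a fin_num.
  have I0 e' : (0 <= \int[mu]_x U e' x)%E by exact: integral_ge0.
  have p2 : 0 < (2 ^+ n)^-1 :> R by rewrite invr_gt0 exprn_gt0.
  rewrite ge0_fin_numE//; apply: contraTT meanU; rewrite -!leNgt leye_eq => /eqP Uoo.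
  rewrite -ltNge (bigD1 e)//= Uoo mulry gtr0_sg// mul1e addye ?ltry//.
  rewrite gt_eqF// (lt_le_trans (ltNyr 0%R))//; apply: sume_ge0 => e' _.
  by rewrite mule_ge0// lee_fin ltW.
pose a e := fine (\int[mu]_x U e x)%E.
have step (e : signs n) : (outer_expect mu h <=
   (A + c * (2 * a e + 2 * (`|rsum n e (fun=> 1)| * S)))%:E)%E.
  pose V b x := (\int[mu]_y U e (mix d T n b (x, y)))%E.
  have V0 b x : (0 <= V b x)%E by apply: integral_ge0 => y _; exact: U0.
  have mV b : measurable_fun setT (V b).
    have := @measurable_fun_fubini_tonelli_F _ _ _ _ _ mu (U e \o mix d T n b).
    apply; last by move=> xy; exact: U0.
    by apply: measurableT_comp => //; exact: measurable_mix.
  have IV b : (\int[mu]_x V b x = (a e)%:E)%E.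
    by rewrite (ge0_integral_mix _ _ _ P mu Pmu)// /a fineK.
  pose s := 2 * (`|rsum n e (fun=> 1)| * S).
  have s0 : 0 <= s by rewrite !mulr_ge0.
  pose W x := (A%:E + c%:E * (V e x + V (fun i => ~~ e i) x + s%:E))%E.
  have W00 x : (0 <= V e x + V (fun i => ~~ e i) x + s%:E)%E 
    by apply: adde_ge0; [apply: adde_ge0; exact: V0|rewrite lee_fin].
  have mW0 : measurable_fun setT (fun x => V e x + V (fun i => ~~ e i) x + s%:E)%E.
    by apply: emeasurable_funD => //; apply: emeasurable_funD.
  apply: (@le_trans _ _ (\int[mu]_x W x)%E).
    apply: outer_expect_le_integral.
    - by apply: emeasurable_funD => //; exact: measurable_funeM.
    - by move=> x; apply: adde_ge0; [rewrite lee_fin|apply: mule_ge0; rewrite ?lee_fin].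
    - move=> x; apply: hP => g Gg.
      have gU y : (`|rsum n e (fun i => g (tnth y i))|%:E <= U e y)%E.
        by apply: le_trans (kU e y); apply: ereal_sup_ubound; exists g.
      have h1 := partial_rsum_le e e g S (U e) x (Gi _ Gg) (GS _ Gg) (mU e) gU.
      have h2 := partial_rsum_le e (fun i => ~~ e i) g S (U e) x (Gi _ Gg) (GS _ Gg) (mU e) gU.
      (* The sign is +1 where [e i] is false and -1 where it is true, so the unsigned sum is a
         difference of two signed partial sums. *)
      have -> : \sum_(i < n) (g (tnth x i) - mean g) =
        \sum_(i < n) (if ~~ e i then (-1) ^+ e i * (g (tnth x i) - mean g) else 0) -
        \sum_(i < n) (if e i then (-1) ^+ e i * (g (tnth x i) - mean g) else 0).
        rewrite -sumrB; apply: eq_bigr => i _.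
        by case: (e i) => /=; rewrite ?expr0 ?expr1; ring.
      apply: (@le_trans _ _ (V (fun i => ~~ e i) x + (`|rsum n e (fun=> 1)| * S)%:E +
                             (V e x + (`|rsum n e (fun=> 1)| * S)%:E))%E); last first.
        rewrite addeACA -EFinD [X in (X + _ <= _)%E]addeC.
        by rewrite (_ : _ + _ = s)// /s; ring.
      apply: le_trans (leeD h2 h1); rewrite -EFinD lee_fin; exact: ler_normB.
  rewrite /W ge0_integralD//; last 2 first.
    - by move=> x _; apply: mule_ge0; rewrite ?lee_fin.
    - exact: measurable_funeM.
  rewrite integral_cst_probability.
  rewrite ge0_integralZl_EFin// ge0_integralD//; last 2 first.
    - by move=> x _; apply: adde_ge0; exact: V0.
    - exact: emeasurable_funD.
  rewrite integral_cst_probability ge0_integralD//.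
  rewrite !IV -[leLHS]/((A + c * (a e + a e + s))%:E) lee_fin le_eqVlt; apply/orP; left; apply/eqP.
  by rewrite -/s; ring.
have ra : rmean n a <= bB.
  rewrite -lee_fin; apply: le_trans meanU; rewrite /rmean mulr_sumr -sumEFin.
  by apply: lee_sum => e _; rewrite EFinM /a fineK.
case E : (outer_expect mu h) => [r| |]; last by rewrite leNye.
- rewrite lee_fin -[leLHS](rmean_cst n).
  apply: (@le_trans _ _ (rmean n (fun e =>
     A + c * (2 * a e + 2 * (`|rsum n e (fun=> 1)| * S))))).
    by apply: rmean_le => e; have := step e; rewrite E lee_fin.
  rewrite rmeanD rmean_cst rmeanZ rmeanD !rmeanZ lerD2l ler_wpM2l//.
  under [in X in _ + X]eq_fun do rewrite mulrC.
  rewrite rmeanZ.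
  have := rmean_norm_rsum1_le n0; nra.
- by have := step [ffun=> true]; rewrite E leye_eq.
Qed.

End symmetrization.

(** * Interpolation of powers and real inequalities *)

Section interpolation.
Context {R : realType}.

Lemma powR_weighted_le (u v t : R) : 0 <= u -> 0 <= v -> 0 < t < 1 ->
  u `^ t * v `^ (1 - t) <= u + v.
Proof.
move=> u0 v0 /andP[t0 t1]; set m := Num.max u v.
have m0 : 0 <= m by rewrite le_max u0.
have tm : m `^ t * m `^ (1 - t) = m.
  have e1 : t + (1 - t) = 1 by ring.
  by rewrite -powRD e1 ?powRr1// oner_eq0.
apply: (@le_trans _ _ (m `^ t * m `^ (1 - t))).
  apply: ler_pM; rewrite ?powR_ge0//; apply: ge0_ler_powR; rewrite ?nnegrE//;
    by [lra|rewrite le_max lexx ?orbT].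
by rewrite tm ge_max lerDl lerDr u0 v0.
Qed.

(** With t = 1/p one has q(1-t) = 4-2t, hence g^4 <= (g^2)^t (y^q)^(1-t). The free scales [c1] and
    [c2] are later set to moments, which makes both quotients of order one on average. *)
Lemma fourth_power_interpolation (p g y c1 c2 : R) : 1 < p -> 0 <= g -> g <= y ->
  0 < c1 -> 0 < c2 ->
  g ^+ 4 <= c1 `^ p^-1 * c2 `^ (1 - p^-1) *
    (g ^+ 2 / c1 + y `^ ((4 * p - 2) / (p - 1)) / c2).
Proof.
move=> p1 g0 gy c10 c20; set t := p^-1; set q := (_ / (p - 1)).
have p0 : 0 < p by lra.
have t0 : 0 < t by rewrite invr_gt0.
have t1 : t < 1 by rewrite invf_lt1.
have y0 : 0 <= y by exact: le_trans gy.
have qt : q * (1 - t) = 4 - 2 * t.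
  by rewrite /q /t; field; rewrite !gt_eqF// subr_gt0.
have [->|gneq0] := eqVneq g 0.
  rewrite expr0n/=; apply: mulr_ge0; first by rewrite mulr_ge0 ?powR_ge0.
  by rewrite expr0n/= mul0r add0r divr_ge0 ?powR_ge0// ltW.
have g_gt0 : 0 < g by rewrite lt_neqAle eq_sym gneq0.
have y_gt0 : 0 < y by exact: lt_le_trans gy.
have H := powR_weighted_le (g ^+ 2 / c1) (y `^ q / c2) t.
have {}H : (g ^+ 2 / c1) `^ t * (y `^ q / c2) `^ (1 - t) <=
    g ^+ 2 / c1 + y `^ q / c2.
  apply: H; last by rewrite t0.
    by rewrite divr_ge0 ?sqr_ge0// ltW.
  by rewrite divr_ge0 ?powR_ge0// ltW.
have c1t : 0 < c1 `^ t by exact: powR_gt0.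
have c2t : 0 < c2 `^ (1 - t) by exact: powR_gt0.
apply: (@le_trans _ _ (c1 `^ t * c2 `^ (1 - t) *
   ((g ^+ 2 / c1) `^ t * (y `^ q / c2) `^ (1 - t)))); last first.
  by rewrite ler_pM2l// mulr_gt0.
have E1 : c1 `^ t * (g ^+ 2 / c1) `^ t = g `^ (2 * t).
  rewrite -powRM ?divr_ge0 ?sqr_ge0// ?ltW// mulrC divfK ?gt_eqF//.
  by rewrite -powR_mulrn ?powRrM// ltW.
have E2 : c2 `^ (1 - t) * (y `^ q / c2) `^ (1 - t) = y `^ (4 - 2 * t).
  rewrite -powRM ?divr_ge0 ?powR_ge0// ?ltW// mulrC divfK ?gt_eqF//.
  by rewrite -powRrM qt.
rewrite mulrACA E1 E2.
have -> : g ^+ 4 = g `^ (2 * t) * g `^ (4 - 2 * t).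
  rewrite -powRD ?gneq0 ?implybT// addrC subrK.
  by rewrite powR_mulrn.
rewrite ler_pM2l ?powR_gt0//; apply: ge0_ler_powR; rewrite ?nnegrE//; lra.
Qed.

(** Divide by T^t and take the root of order 2-t; since this order is at least 1, the root of [K] is
    at most [K]. *)
Lemma self_bounding (T D K t : R) : 1 <= T -> 0 <= D -> 1 <= K -> 0 < t < 1 ->
  T ^+ 2 <= K * (1 + D) * T `^ t -> T <= K * (1 + D) `^ (2 - t)^-1.
Proof.
move=> T1 D0 K1 /andP[t0 t1] H.
have T0 : 0 < T by lra.
have t2 : 0 < 2 - t by lra.
have {}H : T `^ (2 - t) <= K * (1 + D).
  rewrite powRB ?(gt_eqF T0) ?implybT// ler_pdivrMr ?powR_gt0//.
  by rewrite powR_mulrn// ltW.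
have -> : T = (T `^ (2 - t)) `^ (2 - t)^-1.
  by rewrite -powRrM divff ?gt_eqF// powRr1// ltW.
have KD : 0 <= K * (1 + D) by rewrite mulr_ge0; lra.
apply: (@le_trans _ _ ((K * (1 + D)) `^ (2 - t)^-1)).
  by apply: ge0_ler_powR; rewrite ?nnegrE ?powR_ge0// invr_ge0 ltW.
rewrite powRM; [|lra..].
rewrite ler_wpM2r ?powR_ge0//.
by apply: ler1_powR => //; rewrite invf_le1//; lra.
Qed.

(** Linearizes a square root: sqrt(y) <= (y/s + s)/2. Random norms thereby become affine in
    quantities whose integrals are known, so Jensen's inequality is avoided. *)
Lemma sqr_avg_ge (y s : R) : 0 < s -> y <= ((y / s + s) / 2) ^+ 2.
Proof.
move=> s0; have -> : y = (y / s) * s by rewrite divfK// gt_eqF.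
have := sqr_ge0 (y / s - s); rewrite mulfK ?gt_eqF//; nra.
Qed.

End interpolation.

(** * Symmetrization with an affine bound on the Rademacher supremum *)

Section linear_majorant.
Context {R : realType} d (T : measurableType d) (n : nat).
Variables (P : probability T R) (mu : probability (n.-tuple T) R).
Hypothesis Pmu : is_product_measure P mu.

(** The conditional bound is asked only where [W] is finite; elsewhere the majorant [B] is +oo.
    Being affine in [W] and in a sum over coordinates, [B] is integrated term by term. *)
Lemma symmetrization_linear (G : set (T -> R)) (S A c k0 k1 w Phi : R)
    (phi : T -> R) (W h : n.-tuple T -> \bar R) :
  (0 < n)%N -> G !=set0 -> P_measurable P G ->
  (forall g, G g -> P.-integrable setT (EFin \o g)) ->
  (forall g, G g -> `|fine (\int[P]_y (g y)%:E)%E| <= S) -> 0 <= A -> 0 <= c ->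
  0 <= k0 -> 0 < k1 -> measurable_fun setT W -> (forall x, 0 <= W x)%E ->
  (\int[mu]_x W x <= w%:E)%E ->
  measurable_fun setT phi -> (forall y, 0 <= phi y) ->
  (\int[P]_y (phi y)%:E = Phi%:E)%E ->
  (forall x r, W x = r%:E -> (rademacher_sup d T n G x <=
     (k0 + k1 * r + \sum_(i < n) phi (tnth x i))%:E)%E) ->
  (forall x u, (forall g, G g ->
       (`|\sum_(i < n) (g (tnth x i) - fine (\int[P]_y (g y)%:E)%E)|%:E <= u)%E) ->
     (h x <= A%:E + c%:E * u)%E) ->
  (outer_expect mu h <=
    (A + c * (2 * (k0 + k1 * w + n%:R * Phi) + 6 * Num.sqrt n%:R * S))%:E)%E.
Proof.
move=> n0 G0 mG Gi GS A0 c0 k00 k10 mW W0 iW mphi phi0 iphi supB hP.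
pose B x := (k0%:E + k1%:E * W x + \sum_(i < n) (phi (tnth x i))%:E)%E.
have mt (i : 'I_n) : measurable_fun setT (fun x : n.-tuple T => (phi (tnth x i))%:E).
  apply/measurable_EFinP; apply: (measurableT_comp mphi).
  exact: measurable_tnth.
have mkW : measurable_fun setT (fun x => k1%:E * W x)%E by exact: measurable_funeM.
have kW0 x : (0 <= k1%:E * W x)%E by rewrite mule_ge0// lee_fin ltW.
have mS : measurable_fun setT (fun x : n.-tuple T => \sum_(i < n) (phi (tnth x i))%:E)%E.
  by apply: emeasurable_sum => i; exact: mt.
have S0 (x : n.-tuple T) : (0 <= \sum_(i < n) (phi (tnth x i))%:E)%E.
  by apply: sume_ge0 => i _; rewrite lee_fin.
have mkW' : measurable_fun setT (fun x => k0%:E + k1%:E * W x)%E.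
  exact: emeasurable_funD.
have kW0' x : (0 <= k0%:E + k1%:E * W x)%E by rewrite adde_ge0// lee_fin.
apply: (symmetrization d T n P mu Pmu G S A c _ B h) => //.
- exact: emeasurable_funD.
- move=> x; case E : (W x) => [r| |].
  + rewrite (le_trans (supB _ _ E))// /B E sumEFin.
    by rewrite -EFinM -!EFinD.
  + rewrite /B E mulry gtr0_sg// mul1e addey// addye ?leey//.
    by rewrite gt_eqF// (lt_le_trans (ltNyr 0%R)).
  + by have := W0 x; rewrite E.
- rewrite /B ge0_integralD// ge0_integralD//.
  rewrite integral_cst_probability ge0_integralZl_EFin//; last exact: ltW.
  rewrite ge0_integral_sum//; last by move=> i x _; rewrite lee_fin.
  have -> : (\sum_(i < n) \int[mu]_x (phi (tnth x i))%:E = (n%:R * Phi)%:E)%E.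
    rewrite (eq_bigr (fun=> Phi%:E)) => [|i _]; last first.
      by rewrite (ge0_integral_tnth _ _ _ P mu Pmu i (EFin \o phi))//;
        exact/measurable_EFinP.
    by rewrite sumEFin sumr_const card_ord mulr_natl.
  rewrite !EFinD leeD2r// leeD2l// EFinM lee_wpmul2l// lee_fin ltW//.
Qed.

End linear_majorant.

(** * The local maximal inequality *)

Section local_maximal.
Context {R : realType} (p : R) d (T : measurableType d) (n : nat).
Variables (P : probability T R) (mu : probability (n.-tuple T) R).
Variables (Fc : set (T -> R)) (F : T -> R) (delta J1 J2 E2 Eq : R).
Let q := (4 * p - 2) / (p - 1).
Let t := p^-1.
Let s : R := Num.sqrt n%:R.
Let N2 := Num.sqrt E2.
(** The quotient [a / E2] is the ratio of norms in the theorem, as [norm_ratioE] shows. *)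
Let a := Num.sqrt (E2 `^ t * Eq `^ (1 - t)).
Let mean (g : T -> R) : R := fine (\int[P]_y (g y)%:E)%E.
Hypotheses (p1 : 1 < p) (Pmu : is_product_measure P mu) (n0 : (0 < n)%N).
Hypotheses (Fc0 : Fc !=set0) (mFc : forall f, Fc f -> measurable_fun setT f).
Hypotheses (mF : measurable_fun setT F).
Hypotheses (FcF : forall f, Fc f -> forall x, `|f x| <= F x).
Hypotheses (iF2 : (\int[P]_x (F x ^+ 2)%:E = E2%:E)%E) (E20 : 0 < E2).
Hypotheses (iFq : (\int[P]_x (F x `^ q)%:E = Eq%:E)%E) (Eq0 : 0 < Eq).
Hypotheses (PFc : P_measurable P Fc).
Hypotheses (PFc2 : P_measurable P [set (fun x => f x ^+ 2) | f in Fc]).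
Hypotheses (d0 : 0 < delta).
Hypothesis (small : forall f, Fc f ->
  (\int[P]_x (f x ^+ 2)%:E <= (delta ^+ 2 * E2)%:E)%E).
Hypotheses (HJ1 : (unif_entropy delta Fc F <= J1%:E)%E) (J1d : delta / 4 <= J1).
Hypotheses (HJ2 : (unif_entropy (delta `^ t) Fc F <= J2%:E)%E) (J20 : 0 < J2).

Let t01 : 0 < t < 1.
Proof.
have p0 : 0 < p by exact: lt_trans p1.
by rewrite /t invr_gt0 p0 invf_lt1.
Qed.

Let s_gt0 : 0 < s. Proof. by rewrite sqrtr_gt0 ltr0n. Qed.

Let s2 : n%:R = s ^+ 2. Proof. by rewrite sqr_sqrtr. Qed.

Let N2_gt0 : 0 < N2. Proof. by rewrite sqrtr_gt0. Qed.

Let N22 : N2 ^+ 2 = E2. Proof. by rewrite sqr_sqrtr// ltW. Qed.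

Let a_gt0 : 0 < a. Proof. by rewrite sqrtr_gt0 mulr_gt0// powR_gt0. Qed.

Let a2 : a ^+ 2 = E2 `^ t * Eq `^ (1 - t).
Proof. by rewrite sqr_sqrtr// mulr_ge0// powR_ge0. Qed.

Let F0 x : 0 <= F x.
Proof. by have [f /FcF/(_ x)] := Fc0; apply: le_trans. Qed.

Let J10 : 0 < J1. Proof. by rewrite (lt_le_trans _ J1d)// divr_gt0. Qed.

Lemma ge0_integral_EFinZ (c : R) (f : T -> R) (I : R) : 0 <= c ->
  measurable_fun setT f -> (forall x, 0 <= f x) ->
  (\int[P]_x (f x)%:E = I%:E -> \int[P]_x (c * f x)%:E = (c * I)%:E)%E.
Proof.
move=> c0 mf f0 fI; under eq_integral do rewrite EFinM.
rewrite ge0_integralZl_EFin// ?fI//; first by move=> x _; rewrite lee_fin.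
exact/measurable_EFinP.
Qed.

Lemma ge0_integral_EFinD (f g : T -> R) (I J : R) :
  measurable_fun setT f -> (forall x, 0 <= f x) ->
  measurable_fun setT g -> (forall x, 0 <= g x) ->
  (\int[P]_x (f x)%:E = I%:E -> \int[P]_x (g x)%:E = J%:E ->
   \int[P]_x (f x + g x)%:E = (I + J)%:E)%E.
Proof.
move=> mf f0 mg g0 fI gJ; under eq_integral do rewrite EFinD.
rewrite ge0_integralD// ?fI ?gJ//.
- by move=> x _; rewrite lee_fin.
- exact/measurable_EFinP.
- by move=> x _; rewrite lee_fin.
- exact/measurable_EFinP.
Qed.

Lemma class_sqr_integrable f : Fc f -> P.-integrable setT (EFin \o (fun x => f x ^+ 2)).
Proof.
move=> Ff; apply/integrableP; split.
  by apply/measurable_EFinP; apply: measurable_funX; exact: mFc.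
rewrite (eq_integral (fun x => (f x ^+ 2)%:E)) => [|x _].
  by rewrite (le_lt_trans (small _ Ff))// ltry.
by rewrite /= ger0_norm// sqr_ge0.
Qed.

Lemma class_sqr_mean f : Fc f -> 0 <= mean (fun x => f x ^+ 2) <= delta ^+ 2 * E2.
Proof.
move=> Ff; apply/andP; split.
  by apply: fine_ge0; apply: integral_ge0 => x _; rewrite lee_fin sqr_ge0.
rewrite -lee_fin /mean fineK; first exact: small.
exact: (integrable_fin_num measurableT (class_sqr_integrable _ Ff)).
Qed.

(** The pointwise bound |f| <= f^2/(2c) + c/2 with c = delta N2 replaces the Cauchy-Schwarz
    inequality. *)
Lemma class_norm_integral f : Fc f -> (\int[P]_x `|f x|%:E <= (delta * N2)%:E)%E.
Proof.
move=> Ff; pose c := delta * N2.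
have c0 : 0 < c by rewrite mulr_gt0.
have I2 := class_sqr_mean _ Ff.
have If : (\int[P]_x (f x ^+ 2)%:E = (mean (fun x => f x ^+ 2))%:E)%E.
  rewrite /mean fineK//.
  exact: (integrable_fin_num measurableT (class_sqr_integrable _ Ff)).
have mf2 : measurable_fun setT (fun x => f x ^+ 2).
  by apply: measurable_funX; exact: mFc.
apply: (@le_trans _ _ (\int[P]_x ((2 * c)^-1 * f x ^+ 2 + c / 2)%:E)%E).
  apply: ge0_le_integral => //.
  - by apply/measurable_EFinP; apply: measurableT_comp => //; exact: mFc.
  - apply/measurable_EFinP; apply: measurable_funD => //.
    by apply: measurable_funM.
  - move=> x _; rewrite lee_fin -(real_normK (num_real (f x))).
    have -> : (2 * c)^-1 * `|f x| ^+ 2 + c / 2 =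
        `|f x| + (2 * c)^-1 * (`|f x| - c) ^+ 2 by field; rewrite gt_eqF.
    by rewrite lerDl mulr_ge0 ?sqr_ge0// invr_ge0 mulr_ge0// ltW.
have c20 : 0 <= (2 * c)^-1 by rewrite invr_ge0 mulr_ge0// ltW.
rewrite (ge0_integral_EFinD _ _ ((2 * c)^-1 * mean (fun x => f x ^+ 2)) (c / 2))//.
- rewrite lee_fin; apply: (@le_trans _ _ ((2 * c)^-1 * c ^+ 2 + c / 2)).
    rewrite lerD2r ler_wpM2l//; case/andP : I2 => _ /le_trans; apply.
    by rewrite /c exprMn N22.
  by rewrite le_eqVlt; apply/orP; left; apply/eqP; rewrite -/c; field; rewrite gt_eqF.
- exact: measurable_funM.
- by move=> x; rewrite mulr_ge0// sqr_ge0.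
- by move=> x; rewrite divr_ge0// ltW.
- by apply: ge0_integral_EFinZ => // x; exact: sqr_ge0.
- by rewrite integral_cst_probability.
Qed.

Lemma class_integrable f : Fc f -> P.-integrable setT (EFin \o f).
Proof.
move=> Ff; apply/integrableP; split; first exact/measurable_EFinP/mFc.
exact: le_lt_trans (class_norm_integral _ Ff) (ltry _).
Qed.

Lemma class_mean f : Fc f -> `|mean f| <= delta * N2.
Proof.
move=> Ff; rewrite -lee_fin; apply: le_trans (class_norm_integral _ Ff).
rewrite -abse_EFin /mean fineK; last first.
  exact: (integrable_fin_num measurableT (class_integrable _ Ff)).
by apply: (le_abse_integral P measurableT); exact/measurable_EFinP/mFc.
Qed.

(** * Bounds given a measurable majorant of the sums of squares *)

Section majorant.
Variables (z : R) (W : n.-tuple T -> \bar R).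
Hypotheses (z0 : 0 < z) (mW : measurable_fun setT W).
Hypothesis MW : forall x f, Fc f -> ((\sum_(i < n) f (tnth x i) ^+ 2)%:E <= W x)%E.
Hypothesis iW : (\int[mu]_x W x <= (n%:R * (z ^+ 2 * E2))%:E)%E.

Let W0 x : (0 <= W x)%E.
Proof.
have [f Ff] := Fc0; apply: le_trans (MW x f Ff).
by rewrite lee_fin; apply: sumr_ge0 => i _; exact: sqr_ge0.
Qed.

Let z2E0 : 0 < z ^+ 2 * E2. Proof. by rewrite mulr_gt0// exprn_gt0. Qed.

Let sumq (x : n.-tuple T) := \sum_(i < n) F (tnth x i) `^ q.

Lemma sum_fourth_power_le (x : n.-tuple T) (g : T -> R) (c1 m : R) :
  (forall y, `|g y| <= F y) -> 0 < c1 ->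
  \sum_(i < n) g (tnth x i) ^+ 2 <= m ->
  \sum_(i < n) g (tnth x i) ^+ 4 <=
    c1 `^ t * Eq `^ (1 - t) * (m / c1 + sumq x / Eq).
Proof.
move=> gF c10 gm.
apply: (@le_trans _ _ (c1 `^ t * Eq `^ (1 - t) *
  ((\sum_(i < n) g (tnth x i) ^+ 2) / c1 + sumq x / Eq))); last first.
  rewrite ler_wpM2l ?mulr_ge0 ?powR_ge0// lerD2r ler_wpM2r// invr_ge0.
  exact: ltW.
rewrite !mulr_suml -big_split/= mulr_sumr; apply: ler_sum => i _.
have := fourth_power_interpolation p `|g (tnth x i)| _ c1 Eq p1 (normr_ge0 _)
  (gF _) c10 Eq0.
have -> : `|g (tnth x i)| ^+ 4 = g (tnth x i) ^+ 4.
  by rewrite (exprM _ 2 2) real_normK ?num_real// -exprM.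
by rewrite real_normK ?num_real.
Qed.

(** Entropy is used at scale delta^t because interpolation bounds the fourth powers of the class by
    (z^t a)^2 times a random factor: dividing the root by delta^t leaves (z/delta)^t. The first and
    last terms come from the means of f^2. *)
Lemma outer_expect_sqr :
  (outer_expect mu (fun x => ereal_sup
     [set (\sum_(i < n) f (tnth x i) ^+ 2)%R%:E | f in Fc]) <=
   (n%:R * (delta ^+ 2 * E2) +
    (2 * (180 * J2 * a * s * (1 + z `^ t / delta `^ t)) +
     6 * s * (delta ^+ 2 * E2)))%R%:E)%E.
Proof.
have dt0 : 0 < delta `^ t by exact: powR_gt0.
have zt0 : 0 < z `^ t by exact: powR_gt0.
pose tau := z `^ t / delta `^ t.
have tau0 : 0 < tau by rewrite divr_gt0.
pose c := 60 * J2 * a.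
have c0 : 0 < c by rewrite !mulr_gt0.
(* The coefficients [al], [be], [k0] and [k1] are read off by expanding [c * (2 * LY' + tau * LY)]
   below in the envelope sums, a constant, and the value of [W]. *)
pose al := c / (s * E2).
pose be := c * (1 + tau / 2) / (s * Eq).
pose k0 := c * s * (1 + tau / 2).
pose k1 := c * tau / (2 * s * (z ^+ 2 * E2)).
pose phi y := al * F y ^+ 2 + be * F y `^ q.
have al0 : 0 <= al by rewrite divr_ge0 ?mulr_ge0// ltW.
have be0 : 0 <= be.
  by rewrite divr_ge0 ?mulr_ge0 ?addr_ge0 ?divr_ge0// ltW.
have mF2 : measurable_fun setT (fun y => F y ^+ 2) by exact: measurable_funX.
have mFq : measurable_fun setT (fun y => F y `^ q).
  exact: (measurableT_comp (measurable_powR q) mF).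
have iphi : (\int[P]_y (phi y)%:E = (al * E2 + be * Eq)%:E)%E.
  apply: ge0_integral_EFinD.
  - exact: measurable_funM.
  - by move=> y; rewrite mulr_ge0// sqr_ge0.
  - exact: measurable_funM.
  - by move=> y; rewrite mulr_ge0// powR_ge0.
  - by apply: ge0_integral_EFinZ => // y; exact: sqr_ge0.
  - by apply: ge0_integral_EFinZ => // y; exact: powR_ge0.
have := symmetrization_linear d T n P mu Pmu
  [set (fun x => f x ^+ 2) | f in Fc] (delta ^+ 2 * E2)
  (n%:R * (delta ^+ 2 * E2)) 1 k0 k1 (n%:R * (z ^+ 2 * E2)) (al * E2 + be * Eq) phi W.
move=> H; apply: (le_trans (H _ _ _ _ _ _ _ _ _ _ _ _ _ _ _ _ _ _)) => //.
- by have [f Ff] := Fc0; exists (fun x => f x ^+ 2); exists f.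
- by move=> _ [f Ff <-]; exact: class_sqr_integrable.
- move=> _ [f Ff <-]; have /andP[m0 m1] := class_sqr_mean _ Ff.
  by rewrite ger0_norm.
- by rewrite !mulr_ge0// ?sqr_ge0// ltW.
- by rewrite /k0 !mulr_ge0 ?addr_ge0 ?divr_ge0// ltW.
- by apply: divr_gt0; [exact: mulr_gt0|apply: mulr_gt0 => //; exact: mulr_gt0].
- by apply: measurable_funD; exact: measurable_funM.
- by move=> y; rewrite addr_ge0// mulr_ge0// ?sqr_ge0 ?powR_ge0.
- move=> x r Wr.
  have r0 : 0 <= r by rewrite -lee_fin -Wr.
  have q0 : 0 <= sumq x by apply: sumr_ge0 => i _; exact: powR_ge0.
  pose A2 := \sum_(i < n) F (tnth x i) ^+ 2.
  have A20 : 0 <= A2 by apply: sumr_ge0 => i _; exact: sqr_ge0.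
  pose Y := r / (z ^+ 2 * E2) + sumq x / Eq.
  pose Y' := A2 / E2 + sumq x / Eq.
  have Y0 : 0 <= Y by rewrite addr_ge0// divr_ge0// ltW.
  have Y'0 : 0 <= Y' by rewrite addr_ge0// divr_ge0// ltW.
  pose LY := (Y / s + s) / 2.
  pose LY' := (Y' / s + s) / 2.
  have LY0 : 0 <= LY by rewrite divr_ge0// addr_ge0 ?divr_ge0// ltW.
  have LY'0 : 0 <= LY' by rewrite divr_ge0// addr_ge0 ?divr_ge0// ltW.
  have HF4 : Num.sqrt (\sum_(i < n) F (tnth x i) ^+ 4) <= a * LY'.
    have aL : 0 <= a * LY' by apply: mulr_ge0 => //; exact: ltW.
    rewrite -[leRHS](ger0_norm aL) -sqrtr_sqr ler_sqrt ?sqr_ge0//.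
    have := sum_fourth_power_le x F E2 A2 _ E20 (lexx _).
    move=> /(_ _)/le_trans; apply => [y|]; first by rewrite ger0_norm.
    rewrite -a2 exprMn ler_wpM2l ?sqr_ge0// -/Y'; exact: sqr_avg_ge.
  have Hf4 f : Fc f -> \sum_(i < n) f (tnth x i) ^+ 4 <= (z `^ t * a * LY) ^+ 2.
    move=> Ff.
    have fr : \sum_(i < n) f (tnth x i) ^+ 2 <= r by rewrite -lee_fin -Wr; exact: MW.
    apply: le_trans (sum_fourth_power_le x f _ r (FcF _ Ff) z2E0 fr) _.
    have -> : (z ^+ 2 * E2) `^ t * Eq `^ (1 - t) = (z `^ t * a) ^+ 2.
      rewrite powRM ?sqr_ge0 ?(ltW E20)// exprMn a2 mulrA; congr (_ * _ * _).
      by rewrite -powR_mulrn ?ltW// powRAC powR_mulrn ?powR_ge0.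
    by rewrite [leRHS]exprMn ler_wpM2l ?sqr_ge0// -/Y; exact: sqr_avg_ge.
  have zaL : 0 <= z `^ t * a * LY by apply: mulr_ge0 => //; apply: mulr_ge0; exact: ltW.
  apply: le_trans (rademacher_class_sqr d T Fc F (delta `^ t) J2 Fc0 FcF dt0 HJ2
     (ltW J20) n x _ zaL Hf4) _.
  rewrite lee_fin.
  apply: (@le_trans _ _ (c * (2 * LY' + tau * LY))).
    have -> : c * (2 * LY' + tau * LY) =
        60 * J2 * (2 * (a * LY') + z `^ t * a * LY / delta `^ t).
      by rewrite /c /tau; field; rewrite gt_eqF.
    by rewrite ler_pM2l ?mulr_gt0// lerD2r ler_pM2l.
  rewrite le_eqVlt; apply/orP; left; apply/eqP.
  have -> : \sum_(i < n) phi (tnth x i) = al * A2 + be * sumq x.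
    by rewrite /A2 /sumq !mulr_sumr -big_split.
  rewrite /k0 /k1 /al /be /LY /LY' /Y /Y'.
  by field; rewrite !gt_eqF//= ?Eq0 ?E20 ?s_gt0 ?z0.
- move=> x u Hu; apply: ge_ereal_sup => _ [f Ff <-].
  have Hm := Hu (fun y => f y ^+ 2); rewrite mul1e.
  have {}Hm : (`|\sum_(i < n) (f (tnth x i) ^+ 2 - mean (fun y => f y ^+ 2))|%:E <= u)%E.
    by apply: Hm; exists f.
  have /andP[_ m1] := class_sqr_mean _ Ff.
  apply: (@le_trans _ _ ((n%:R * (delta ^+ 2 * E2))%:E +
     `|\sum_(i < n) (f (tnth x i) ^+ 2 - mean (fun y => f y ^+ 2))|%:E)%E); last exact: leeD2l.
  rewrite -EFinD lee_fin.
  have -> : \sum_(i < n) f (tnth x i) ^+ 2 = n%:R * mean (fun y => f y ^+ 2) +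
     \sum_(i < n) (f (tnth x i) ^+ 2 - mean (fun y => f y ^+ 2)).
    by rewrite sumrB sumr_const card_ord mulr_natl addrC subrK.
  by rewrite lerD ?ler_norm// ler_wpM2l.
rewrite lee_fin mul1r lerD2l lerD2r ler_pM2l// -/s -/tau.
(* With the integral of [W] replaced by its bound, [LY] and [LY'] each contribute 3s/2, so the
   factor is 2(3/2) + (3/2) tau. *)
have -> : k0 + k1 * (n%:R * (z ^+ 2 * E2)) + n%:R * (al * E2 + be * Eq) =
    c * s * (3 + 3 / 2 * tau).
  rewrite s2 /k0 /k1 /al /be.
  by field; rewrite !gt_eqF//= ?Eq0 ?E20 ?s_gt0 ?z0.
rewrite /c; have := mulr_gt0 (mulr_gt0 J20 a_gt0) s_gt0; nra.
Qed.

(** Same scheme at scale delta, now with second powers only: sums of squares are bounded by [W]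
    directly, so z/delta enters to the first power. *)
Lemma outer_expect_class :
  (outer_expect mu (fun x => ereal_sup
     [set `|s^-1 * \sum_(i < n) (f (tnth x i) - mean f)|%R%:E | f in Fc]) <=
   (s^-1 * (2 * (60 * J1 * N2 * s * (1 + z / delta)) + 6 * s * (delta * N2)))%R%:E)%E.
Proof.
pose tau := z / delta.
have tau0 : 0 < tau by rewrite divr_gt0.
pose c := 60 * J1 * N2.
have c0 : 0 < c by rewrite !mulr_gt0.
pose al := c / (2 * s * E2).
pose k0 := c * s * (1 + tau) / 2.
pose k1 := c * tau / (2 * s * (z ^+ 2 * E2)).
pose phi y := al * F y ^+ 2.
have al0 : 0 <= al by rewrite divr_ge0 ?mulr_ge0// ltW.
have mF2 : measurable_fun setT (fun y => F y ^+ 2) by exact: measurable_funX.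
have iphi : (\int[P]_y (phi y)%:E = (al * E2)%:E)%E.
  by apply: ge0_integral_EFinZ => // y; exact: sqr_ge0.
have := symmetrization_linear d T n P mu Pmu Fc (delta * N2)
  0 s^-1 k0 k1 (n%:R * (z ^+ 2 * E2)) (al * E2) phi W.
move=> H; apply: (le_trans (H _ _ _ _ _ _ _ _ _ _ _ _ _ _ _ _ _ _)) => //.
- exact: class_integrable.
- exact: class_mean.
- by rewrite invr_ge0 ltW.
- by rewrite /k0 divr_ge0// !mulr_ge0 ?addr_ge0// ltW.
- by apply: divr_gt0; [exact: mulr_gt0|apply: mulr_gt0 => //; exact: mulr_gt0].
- exact: measurable_funM.
- by move=> y; rewrite mulr_ge0// sqr_ge0.
- move=> x r Wr.
  have r0 : 0 <= r by rewrite -lee_fin -Wr.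
  pose A2 := \sum_(i < n) F (tnth x i) ^+ 2.
  have A20 : 0 <= A2 by apply: sumr_ge0 => i _; exact: sqr_ge0.
  pose LY := (r / (z ^+ 2 * E2) / s + s) / 2.
  pose LY' := (A2 / E2 / s + s) / 2.
  have LY0 : 0 <= LY by rewrite divr_ge0// addr_ge0 ?divr_ge0// ltW.
  have LY'0 : 0 <= LY' by rewrite divr_ge0// addr_ge0 ?divr_ge0// ltW.
  have HF2 : Num.sqrt A2 <= N2 * LY'.
    have aL : 0 <= N2 * LY' by apply: mulr_ge0 => //; exact: ltW.
    rewrite -[leRHS](ger0_norm aL) -sqrtr_sqr ler_sqrt ?sqr_ge0//.
    rewrite exprMn N22 mulrC -ler_pdivrMr//; exact: sqr_avg_ge.
  have Hf2 f : Fc f -> \sum_(i < n) f (tnth x i) ^+ 2 <= (z * N2 * LY) ^+ 2.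
    move=> Ff; apply: (@le_trans _ _ r); first by rewrite -lee_fin -Wr; exact: MW.
    rewrite exprMn [(z * N2) ^+ 2]exprMn N22 mulrC -ler_pdivrMr//.
    exact: sqr_avg_ge.
  have zaL : 0 <= z * N2 * LY by apply: mulr_ge0 => //; apply: mulr_ge0; exact: ltW.
  apply: le_trans (rademacher_class d T Fc F delta J1 Fc0 FcF d0 HJ1
     (ltW J10) n x _ zaL Hf2) _.
  rewrite lee_fin.
  apply: (@le_trans _ _ (c * (LY' + tau * LY))).
    have -> : c * (LY' + tau * LY) = 60 * J1 * (N2 * LY' + z * N2 * LY / delta).
      by rewrite /c /tau; field; rewrite gt_eqF.
    by rewrite ler_pM2l ?mulr_gt0// lerD2r.
  rewrite le_eqVlt; apply/orP; left; apply/eqP.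
  have -> : \sum_(i < n) phi (tnth x i) = al * A2.
    by rewrite /A2 mulr_sumr.
  rewrite /k0 /k1 /al /LY /LY'.
  by field; rewrite !gt_eqF//= ?E20 ?s_gt0 ?z0.
- move=> x u Hu; apply: ge_ereal_sup => _ [f Ff <-].
  rewrite add0e normrM gtr0_norm ?invr_gt0// EFinM lee_wpmul2l//.
    by rewrite lee_fin invr_ge0 ltW.
  exact: Hu.
rewrite lee_fin add0r ler_pM2l ?invr_gt0// lerD2r ler_pM2l// -/tau.
have -> : k0 + k1 * (n%:R * (z ^+ 2 * E2)) + n%:R * (al * E2) =
    c * s * (1 + tau).
  rewrite s2 /k0 /k1 /al.
  by field; rewrite !gt_eqF//= ?E20 ?s_gt0 ?z0.
by rewrite /c.
Qed.

End majorant.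

Lemma local_maximal_inequality :
  (outer_expect mu (fun x => ereal_sup
     [set `|s^-1 * \sum_(i < n) (f (tnth x i) - mean f)|%R%:E | f in Fc]) <=
   (288 * 2880 * J1 * (1 + J2 * ((delta ^+ 2 * s)^-1 * (a / E2))) `^ (2 - t)^-1 *
    N2)%R%:E)%E.
Proof.
pose M (x : n.-tuple T) := ereal_sup [set (\sum_(i < n) f (tnth x i) ^+ 2)%:E | f in Fc].
have MU x f : Fc f -> ((\sum_(i < n) f (tnth x i) ^+ 2)%:E <= M x)%E.
  by move=> Ff; apply: ereal_sup_ubound; exists f.
have M0 x : (0 <= M x)%E.
  have [f Ff] := Fc0; apply: le_trans (MU x f Ff).
  by rewrite lee_fin; apply: sumr_ge0 => i _; exact: sqr_ge0.
have E0ge : (0 <= outer_expect mu M)%E.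
  apply: le_ereal_inf_tmp => _ [U [mU MleU _] <-].
  by apply: integral_ge0 => x _; exact: le_trans (MleU x).
have mF2 : measurable_fun setT (fun y => F y ^+ 2) by exact: measurable_funX.
have E0le : (outer_expect mu M <= (n%:R * E2)%:E)%E.
  have mi (i : 'I_n) : measurable_fun setT (fun x : n.-tuple T => (F (tnth x i) ^+ 2)%:E).
    apply/measurable_EFinP; apply: (measurableT_comp mF2).
    exact: measurable_tnth.
  have i0 (i : 'I_n) (x : n.-tuple T) : (0 <= (F (tnth x i) ^+ 2)%:E)%E.
    by rewrite lee_fin sqr_ge0.
  apply: le_trans (outer_expect_le_integral d T n mu _
    (fun x => \sum_(i < n) (F (tnth x i) ^+ 2)%:E)%E _ _ _) _.
  - by apply: emeasurable_sum => i; exact: mi.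
  - by move=> x; exact: sume_ge0.
  - move=> x; apply: ge_ereal_sup => _ [f Ff <-]; rewrite sumEFin lee_fin.
    apply: ler_sum => i _; rewrite -[leLHS]real_normK ?num_real//.
    by rewrite lerXn2r ?nnegrE ?FcF.
  rewrite ge0_integral_sum//.
  rewrite (eq_bigr (fun=> E2%:E)) => [|i _]; last first.
    rewrite (ge0_integral_tnth _ _ _ P mu Pmu i (EFin \o (fun y => F y ^+ 2)))//.
      exact/measurable_EFinP.
    by move=> y; rewrite lee_fin sqr_ge0.
  by rewrite sumEFin sumr_const card_ord mulr_natl.
have [m0 m0E] : exists m0, outer_expect mu M = m0%:E.
  case: (outer_expect mu M) E0ge E0le => [m0 _ _|_|]; [by exists m0| |].
    by rewrite leye_eq.
  by rewrite leeNy_eq.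
have m00 : 0 <= m0 by rewrite -lee_fin -m0E.
pose z0 := Num.sqrt (m0 / (n%:R * E2)).
have z00 : 0 <= z0 by exact: sqrtr_ge0.
have nE0 : 0 < n%:R * E2 by rewrite mulr_gt0// ltr0n.
have z0E : m0 = n%:R * (z0 ^+ 2 * E2).
  by rewrite sqr_sqrtr ?divr_ge0// ?(ltW nE0)// mulrCA divfK// gt_eqF.
(* Doubling z0/delta makes [z] strictly larger than [z0], so that some admissible majorant [W]
   integrates to at most n z^2 E2. The floor 2 keeps [z] positive when [z0] vanishes and makes
   [Tm >= 1], as [self_bounding] requires. *)
pose Tm := Num.max 2 (2 * z0 / delta).
have Tm2 : 2 <= Tm by rewrite le_max lexx.
have Tmz : 2 * z0 / delta <= Tm by rewrite le_max lexx orbT.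
pose z := Tm * delta.
have z_gt0 : 0 < z by rewrite mulr_gt0//; lra.
have z0z : z0 < z.
  by move: Tmz; rewrite ler_pdivrMr// -/z; lra.
have : (outer_expect mu M < (n%:R * (z ^+ 2 * E2))%:E)%E.
  rewrite m0E lte_fin z0E ltr_pM2l ?ltr0n// ltr_pM2r// ltr_pXn2r// nnegrE.
  exact: ltW.
move=> /ereal_inf_lt[_ [W [mW MleW _] <-] /ltW iW].
have MW x f : Fc f -> ((\sum_(i < n) f (tnth x i) ^+ 2)%:E <= W x)%E.
  by move=> Ff; exact: le_trans (MU x f Ff) (MleW x).
have := outer_expect_sqr z W z_gt0 mW MW iW; rewrite -/M m0E lee_fin.
have -> : z `^ t / delta `^ t = Tm `^ t.
  have Tm0 : 0 <= Tm by lra.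
  by rewrite powRM ?(ltW d0)// mulfK// gt_eqF// powR_gt0.
set tau := Tm `^ t => HA.
have tau1 : 1 <= tau.
  rewrite -[leLHS](powRr0 Tm); apply: ler_powR; first lra.
  by case/andP : t01 => /ltW.
have s1 : 1 <= s by rewrite -[leLHS]sqrtr1 ler_sqrt// ler1n.
set D := J2 * _.
have D0 : 0 < D.
  by rewrite !mulr_gt0// ?invr_gt0// mulr_gt0// exprn_gt0.
(* The bound on [m0] gives z0^2/delta^2 <= 7 + 360 D (1 + tau), where 7 = 1 + 6 uses s <= s^2. Then
   Tm^2 <= 4 + 4 z0^2/delta^2 <= 32 + 1440 D (1 + tau), and tau >= 1 gives 2880 (1 + D) tau. *)
have Tbound : Tm <= 2880 * (1 + D) `^ (2 - t)^-1.
  apply: self_bounding => //; [lra|exact: ltW|lra|].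
  have d20 : 0 < delta ^+ 2 by rewrite exprn_gt0.
  have z0d : z0 ^+ 2 / delta ^+ 2 <= 7 + 360 * (D * (1 + tau)).
    rewrite ler_pdivrMr//.
    have s2E0 : 0 < s ^+ 2 * E2 by rewrite mulr_gt0// exprn_gt0.
    rewrite -(ler_pM2l s2E0).
    have DE : D * (s ^+ 2 * E2 * delta ^+ 2) = J2 * a * s.
      rewrite /D; field; rewrite !gt_eqF//=.
    have -> : s ^+ 2 * E2 * z0 ^+ 2 = m0 by rewrite z0E s2; ring.
    have -> : s ^+ 2 * E2 * ((7 + 360 * (D * (1 + tau))) * delta ^+ 2) =
       7 * (s ^+ 2 * (delta ^+ 2 * E2)) + 360 * (1 + tau) * (J2 * a * s).
      by rewrite -DE; ring.
    apply: le_trans HA _; rewrite s2.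
    have ss : s <= s ^+ 2 by rewrite expr2 ler_peMl// ltW.
    have := ler_wpM2r (ltW (mulr_gt0 d20 E20)) ss; lra.
  have Tm4 : Tm ^+ 2 <= 4 + 4 * (z0 ^+ 2 / delta ^+ 2).
    have zd0 : 0 <= z0 ^+ 2 / delta ^+ 2 by rewrite divr_ge0// ?sqr_ge0// ltW.
    have [->|->] : Tm = 2 \/ Tm = 2 * z0 / delta; [|lra|].
      by rewrite /Tm; case: leP => _; [right|left].
    have -> : (2 * z0 / delta) ^+ 2 = 4 * (z0 ^+ 2 / delta ^+ 2) by rewrite !exprMn exprVn; ring.
    lra.
  apply: le_trans Tm4 _.
  have h1 : D <= D * tau by rewrite ler_peMr// ltW.
  rewrite -/tau; lra.
apply: le_trans (outer_expect_class z W z_gt0 mW MW iW) _.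
have -> : z / delta = Tm by rewrite mulfK// gt_eqF.
rewrite lee_fin.
have -> : s^-1 * (2 * (60 * J1 * N2 * s * (1 + Tm)) + 6 * s * (delta * N2)) =
    120 * (J1 * N2) * (1 + Tm) + 6 * (delta * N2).
  by field; rewrite gt_eqF.
have JN : 0 < J1 * N2 by rewrite mulr_gt0.
have dN : delta * N2 <= 4 * (J1 * N2) by rewrite mulrA ler_pM2r// -ler_pdivrMl// mulrC.
apply: (@le_trans _ _ (288 * (J1 * N2) * Tm)); first nra.
have := ler_wpM2l (ltW JN) Tbound; lra.
Qed.

End local_maximal.

(** * Moments, degenerate cases and the final assembly *)

Lemma measure_probabilityP {R : realType} d (X : measurableType d)
    (mu : {measure set X -> \bar R}) : mu setT = 1%E ->
  exists m : probability X R, mu = m :> {measure set X -> \bar R}.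
Proof.
move=> mu1; exists (mnormalize mu \d_point); apply: eq_measure.
apply/funext => A; rewrite /= /mnormalize mu1 onee_eq0/=.
by rewrite invr1 mule1.
Qed.

(** The threshold [c] is free: [c = 1] shows that F^2 is integrable, and a small [c] shows that the
    moment of order [q] cannot vanish when the second moment is positive. *)
Lemma sqr_le_powR {R : realType} (c y q : R) : 0 < c -> 0 <= y -> 2 <= q ->
  y ^+ 2 <= c ^+ 2 + c `^ (2 - q) * y `^ q.
Proof.
move=> c0 y0 q2; have [yc|cy] := leP y c.
  rewrite (le_trans (_ : _ <= c ^+ 2)) ?lerDl ?mulr_ge0 ?powR_ge0//.
  by rewrite lerXn2r ?nnegrE// ltW.
have y_gt0 : 0 < y by exact: lt_trans cy.
apply: (@le_trans _ _ (c `^ (2 - q) * y `^ q)); last by rewrite lerDr sqr_ge0.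
have -> : y `^ q = y ^+ 2 * y `^ (q - 2).
  by rewrite -powR_mulrn ?ltW// -powRD ?(gt_eqF y_gt0) ?implybT// addrC subrK.
rewrite mulrCA ler_peMr ?sqr_ge0//.
have -> : c `^ (2 - q) = (c `^ (q - 2))^-1 by rewrite -powRN opprB.
rewrite mulrC ler_pdivlMr ?powR_gt0// mul1r.
by apply: ge0_ler_powR; rewrite ?nnegrE ?subr_ge0// ltW.
Qed.

(** Test the supremum on the Dirac measure at [x], whose envelope norm is positive. *)
Lemma unif_entropy_ge {R : realType} d (T : measurableType d) (Fc : set (T -> R))
    (F : T -> R) (delta : R) (x : T) : 0 < delta -> F x != 0 ->
  ((delta / 4)%:E <= unif_entropy delta Fc F)%E.
Proof.
move=> d0 Fx; pose xs (_ : 'I_1) := x; pose w (_ : 'I_1) : R := 1.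
apply: le_trans (entropy_int_ge d T 1 xs w delta Fc F d0) _.
apply: ereal_sup_ubound; exists 1%N, xs, w; split => //.
- by split=> [j|]; rewrite /w ?big_ord1.
- by rewrite /L2fd big_ord1 mul1r sqrtr_gt0 lt_neqAle sqr_ge0 andbT eq_sym sqrf_eq0.
Qed.

Lemma Lnorm_EFin {R : realType} d (T : measurableType d) (P : probability T R)
    (F : T -> R) (r E : R) :
  (\int[P]_x (`|F x| `^ r)%:E = E%:E)%E -> fine 'N[P]_(r%:E)[EFin \o F] = E `^ r^-1.
Proof.
move=> FE; rewrite unlock.
have -> : (\int[P]_x (`|(EFin \o F) x| `^ r) = E%:E)%E.
  by rewrite -FE; apply: eq_integral => x _.
by rewrite poweR_EFin.
Qed.

Lemma norm_ratioE {R : realType} (p E2 Eq : R) : 1 < p -> 0 < E2 -> 0 < Eq ->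
  let t := p^-1 in let q := (4 * p - 2) / (p - 1) in
  (Eq `^ q^-1) `^ (2 - t) / (E2 `^ 2^-1) `^ (2 - t) =
  Num.sqrt (E2 `^ t * Eq `^ (1 - t)) / E2.
Proof.
move=> p1 E20 Eq0 t q.
have p0 : 0 < p by lra.
rewrite -powR12_sqrt ?mulr_ge0 ?powR_ge0// powRM ?powR_ge0// -!powRrM.
have -> : q^-1 * (2 - t) = (1 - t) / 2.
  by rewrite /q /t; field; rewrite !gt_eqF//=; lra.
have -> : E2 `^ (2^-1 * (2 - t)) = E2 / E2 `^ (t / 2).
  apply: (canRL (mulfK _)); first by rewrite gt_eqF// powR_gt0.
  rewrite -powRD ?(gt_eqF E20) ?implybT//.
  have -> : 2^-1 * (2 - t) + t / 2 = 1 by field.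
  by rewrite powRr1// ltW.
by field; rewrite !gt_eqF// powR_gt0.
Qed.

Theorem theorem3p1 (R : realType) (p : R) (hp : 1 < p) :
  exists C : R,
  forall (d : measure_display) (T : measurableType d)
    (P : probability T R) (n : nat)
    (mu : {measure set (n.-tuple T) -> \bar R})
    (Fc : set (T -> R)) (F : T -> R) (delta : R),
  (0 < n)%N ->
  is_product_measure P mu ->
  (forall f, Fc f -> measurable_fun setT f) ->
  measurable_fun setT F ->
  (forall f, Fc f -> forall x, `|f x| <= F x) ->
  (\int[P]_x ((`|F x| `^ ((4 * p - 2) / (p - 1)))%:E) < +oo)%E ->
  P_measurable P Fc ->
  P_measurable P [set (fun x => f x ^+ 2) | f in Fc] ->
  P_measurable P [set (fun x => f x ^+ 4) | f in Fc] ->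
  0 < delta < 1 ->
  (forall f, Fc f ->
     (\int[P]_x ((f x ^+ 2)%:E) < (delta ^+ 2)%:E * \int[P]_x ((F x ^+ 2)%:E))%E) ->
  let q := (4 * p - 2) / (p - 1) in
  let normFq := fine ('N[P]_(q%:E)[EFin \o F]) in
  let normF2 := fine ('N[P]_(2%:E)[EFin \o F]) in
  let Gn (f : T -> R) (x : n.-tuple T) : R :=
    (Num.sqrt n%:R)^-1 * \sum_(i < n) (f (tnth x i) - fine (\int[P]_y (f y)%:E)) in
  (outer_expect mu (fun x => ereal_sup [set (`|Gn f x|)%:E | f in Fc])
   <= C%:E * unif_entropy delta Fc F *
      poweR (1 + unif_entropy (delta `^ p^-1) Fc F *
               ((delta ^+ 2 * Num.sqrt n%:R)^-1 *
                (normFq `^ (2 - p^-1) / normF2 `^ (2 - p^-1)))%:E)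
            (p / (2 * p - 1))
      * normF2%:E)%E.
Proof.
have [C CE C0] : exists2 C : R, C = 288 * 2880 & 0 < C.
  by eexists; first reflexivity; apply: mulr_gt0; rewrite ltr0n.
exists C.
move=> d T P n mu0 Fc F delta n0 Pmu0 mFc mF FcF iFq PFc PFc2 _ /andP[d0 d1] small.
cbv zeta; set q := (4 * p - 2) / (p - 1).
set normFq := fine 'N[P]_(q%:E)[EFin \o F]; set normF2 := fine 'N[P]_(2%:E)[EFin \o F].
have [Fc_eq0|/set0P Fc0] := eqVneq Fc set0.
  (* Over an empty class the supremum is -oo, and the constant -oo is an admissible majorant because
     its positive part is zero. *)
  apply: le_trans (leNye _); apply: ereal_inf_lbound.
  exists (cst -oo%E); last first.
    by rewrite integral_cst// (product_measure_setT _ _ _ P)// mule1.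
  split; first exact: measurable_cst.
    by move=> x; rewrite Fc_eq0 image_set0 ereal_sup0.
  left; rewrite (eq_integral (cst 0%E)) ?integral0 ?ltry// => x _.
  by rewrite funeposE max_r// leNye.
have [mu muE] : exists mu : probability (n.-tuple T) R,
    mu0 = mu :> {measure set (n.-tuple T) -> \bar R}.
  exact: measure_probabilityP (product_measure_setT _ _ _ P _ Pmu0).
rewrite {}muE in Pmu0 *.
have p0 : 0 < p by lra.
have q2 : 2 <= q.
  by rewrite /q ler_pdivlMr; lra.
have F0 x : 0 <= F x by have [f /FcF/(_ x)] := Fc0; apply: le_trans.
have mF2 : measurable_fun setT (fun y => F y ^+ 2) by exact: measurable_funX.
have mFq : measurable_fun setT (fun y => F y `^ q).
  exact: (measurableT_comp (measurable_powR q) mF).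
have [Eq EqE] : exists Eq, (\int[P]_x (F x `^ q)%:E = Eq%:E)%E.
  exists (fine (\int[P]_x (F x `^ q)%:E)); rewrite fineK//.
  rewrite ge0_fin_numE; last by apply: integral_ge0 => x _; rewrite lee_fin powR_ge0.
  apply: le_lt_trans iFq; rewrite le_eqVlt; apply/orP; left; apply/eqP.
  by apply: eq_integral => x _; rewrite ger0_norm.
have F2le c : 0 < c -> (\int[P]_x (F x ^+ 2)%:E <= (c ^+ 2 + c `^ (2 - q) * Eq)%:E)%E.
  move=> c0; have cq0 : 0 <= c `^ (2 - q) by exact: powR_ge0.
  rewrite -(ge0_integral_EFinD d T P (fun=> c ^+ 2) (fun x => c `^ (2 - q) * F x `^ q)).
  - apply: ge0_le_integral => //.
    + by move=> x _; rewrite lee_fin sqr_ge0.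
    + exact/measurable_EFinP.
    + apply/measurable_EFinP; apply: measurable_funD => //; exact: measurable_funM.
    + by move=> x _; rewrite lee_fin; exact: sqr_le_powR.
  - exact: measurable_cst.
  - by move=> x; exact: sqr_ge0.
  - exact: measurable_funM.
  - by move=> x; rewrite mulr_ge0// powR_ge0.
  - exact: integral_cst_probability.
  - by apply: ge0_integral_EFinZ => // x; exact: powR_ge0.
have [E2 E2E] : exists E2, (\int[P]_x (F x ^+ 2)%:E = E2%:E)%E.
  exists (fine (\int[P]_x (F x ^+ 2)%:E)); rewrite fineK//.
  rewrite ge0_fin_numE; last by apply: integral_ge0 => x _; rewrite lee_fin sqr_ge0.
  exact: le_lt_trans (F2le 1 ltr01) (ltry _).
(* Positivity comes from the strict inequality assumed for some [f] in the class. *)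
have E20 : 0 < E2.
  have [f Ff] := Fc0; have := small _ Ff; rewrite E2E -EFinM => lt2.
  have : (0 < (delta ^+ 2 * E2)%:E)%E.
    by apply: le_lt_trans lt2; apply: integral_ge0 => x _; rewrite lee_fin sqr_ge0.
  by rewrite lte_fin pmulr_rgt0// exprn_gt0.
have Eq0 : 0 < Eq.
  have Eq_ge0 : 0 <= Eq.
    by rewrite -lee_fin -EqE; apply: integral_ge0 => x _; rewrite lee_fin powR_ge0.
  rewrite lt_neqAle Eq_ge0 andbT eq_sym; apply/negP => /eqP Eq_eq0.
  have E22 : 0 < E2 / 2 by rewrite divr_gt0.
  have /F2le : 0 < Num.sqrt (E2 / 2) by rewrite sqrtr_gt0.
  rewrite E2E Eq_eq0 mulr0 addr0 (sqr_sqrtr (ltW E22)) lee_fin; lra.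
have [x0 Fx0] : exists x, F x != 0.
  apply: contrapT => /forallNP noF; move: E2E E20.
  rewrite (eq_integral (cst 0%E)) ?integral0 => [[<-]|x _]; first by rewrite ltxx.
  by have /negP := noF x; rewrite negbK => /eqP ->; rewrite expr0n.
have N2E : normF2 = Num.sqrt E2.
  rewrite /normF2 (@Lnorm_EFin _ _ _ _ _ _ E2) ?powR12_sqrt ?ltW// -E2E.
  by apply: eq_integral => x _; rewrite powR_mulrn// real_normK// num_real.
have N2_gt0 : 0 < normF2 by rewrite N2E sqrtr_gt0.
have ratioE : normFq `^ (2 - p^-1) / normF2 `^ (2 - p^-1) =
    Num.sqrt (E2 `^ p^-1 * Eq `^ (1 - p^-1)) / E2.
  rewrite -norm_ratioE// N2E -powR12_sqrt ?ltW// /normFq.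
  rewrite (@Lnorm_EFin _ _ _ _ _ _ Eq)// -EqE.
  by apply: eq_integral => x _; rewrite ger0_norm.
rewrite ratioE; set r := _ * (_ / E2).
have s0 : 0 < Num.sqrt n%:R :> R by rewrite sqrtr_gt0 ltr0n.
have r0 : 0 < r.
  apply: mulr_gt0; first by rewrite invr_gt0 mulr_gt0// exprn_gt0.
  by apply: divr_gt0 => //; rewrite sqrtr_gt0 mulr_gt0// powR_gt0.
have dt0 : 0 < delta `^ p^-1 by exact: powR_gt0.
have := unif_entropy_ge d T Fc F delta x0 d0 Fx0.
have := unif_entropy_ge d T Fc F (delta `^ p^-1) x0 dt0 Fx0.
have e0 : 0 < p / (2 * p - 1) by rewrite divr_gt0//; lra.
(* If either entropy is infinite the right-hand side is +oo, since all the other factors are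
   positive. *)
move=> J2ge; case E1 : (unif_entropy delta Fc F) => [J1| |] J1ge; last 2 first.
- rewrite gt0_muley ?lte_fin ?mulr_gt0//.
  rewrite gt0_mulye ?gt0_mulye ?lte_fin ?leey//.
  apply: poweR_gt0; rewrite (lt_le_trans lte01)// leeDl// mule_ge0//.
    by apply: le_trans J2ge; rewrite lee_fin divr_ge0// ltW.
  by rewrite lee_fin ltW.
- by rewrite leeNy_eq in J1ge.
rewrite lee_fin in J1ge.
case E3 : (unif_entropy (delta `^ p^-1) Fc F) J2ge => [J2| |] J2ge; last 2 first.
- rewrite gt0_mulye ?lte_fin// addey// eqy_poweR//.
  have J10 : 0 < J1 by rewrite (lt_le_trans _ J1ge)// divr_gt0.
  rewrite -EFinM gt0_muley ?lte_fin ?mulr_gt0//.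
  by rewrite gt0_mulye ?lte_fin ?leey.
- by rewrite leeNy_eq in J2ge.
rewrite lee_fin in J2ge.
have J20 : 0 < J2 by rewrite (lt_le_trans _ J2ge)// divr_gt0.
have smallE f : Fc f -> (\int[P]_x (f x ^+ 2)%:E <= (delta ^+ 2 * E2)%:E)%E.
  by move=> Ff; have := small _ Ff; rewrite E2E -EFinM => /ltW.
have HJ1 : (unif_entropy delta Fc F <= J1%:E)%E by rewrite E1.
have HJ2 : (unif_entropy (delta `^ p^-1) Fc F <= J2%:E)%E by rewrite E3.
have := local_maximal_inequality p d T n P mu Fc F delta J1 J2 E2 Eq hp Pmu0 n0 Fc0
  mFc mF FcF E2E E20 EqE Eq0 PFc PFc2 d0 smallE HJ1 J1ge HJ2 J20.
move=> /le_trans; apply.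
have -> : p / (2 * p - 1) = (2 - p^-1)^-1.
  by field; rewrite !gt_eqF//=; lra.
by rewrite N2E -CE; exact: lexx.
Qed.
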